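(* Let $R$ be a ring. If $\mathrm{pd}(\mathcal{FP}\mathrm{Inj}(R))<\infty$ and $\mathrm{id}(\mathrm{Proj}(R))<\infty$, then $\mathrm{gl.G.dim}(R)=\mathrm{gl.D.dim}(R)<\infty$; that is, $\mathrm{gl.DP}(R)=\mathrm{gl.DI}(R)$ and this common value $\mathrm{gl.D.dim}(R)$ is finite and equal to $\mathrm{gl.G.dim}(R)$.
   Context: Rings are associative with unit and modules are left modules. $\mathrm{Proj}(R)$, $\mathrm{Inj}(R)$, $\mathrm{Flat}(R)$ are the classes of projective, injective and flat $R$-modules; $\mathcal{FP}\mathrm{Inj}(R)$ is the class of FP-injective modules, i.e. modules $M$ with $\mathrm{Ext}^1_R(N,M)=0$ for all finitely presented $N$. $\mathrm{pd}$ and $\mathrm{id}$ are projective and injective dimension; for a class $\mathcal{C}$, $\mathrm{pd}(\mathcal{C})$ and $\mathrm{id}(\mathcal{C})$ are the suprema of these over $\mathcal{C}$. For classes $\mathcal{X},\mathcal{Y}$ of modules, $\mathcal{GP}_{(\mathcal{X},\mathcal{Y})}$ is the class of modules that are cycles of an exact complex $X_\bullet$ (indexed by $\mathbb{Z}$) with all $X_m\in\mathcal{X}$ such that $\mathrm{Hom}_R(X_\bullet,Y)$ is exact for all $Y\in\mathcal{Y}$; $\mathcal{GI}_{(\mathcal{X},\mathcal{Y})}$ is the class of modules that are cycles of an exact complex $Y_\bullet$ with all $Y_m\in\mathcal{Y}$ such that $\mathrm{Hom}_R(X,Y_\bullet)$ is exact for all $X\in\mathcal{X}$. $\mathrm{gl.GPD}_{(\mathcal{X},\mathcal{Y})}(R)$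 is the supremum, over all $R$-modules $M$, of the least length of an exact resolution $0\to G_n\to\cdots\to G_0\to M\to0$ with $G_i\in\mathcal{GP}_{(\mathcal{X},\mathcal{Y})}$ ($\infty$ if there is none); $\mathrm{gl.GID}_{(\mathcal{X},\mathcal{Y})}(R)$ is the supremum of the least length of an exact coresolution $0\to M\to E_0\to\cdots\to E_n\to 0$ with $E_i\in\mathcal{GI}_{(\mathcal{X},\mathcal{Y})}$ ($\infty$ if there is none). $\mathrm{gl.DP}(R)=\mathrm{gl.GPD}_{(\mathrm{Proj}(R),\mathrm{Flat}(R))}(R)$ and $\mathrm{gl.DI}(R)=\mathrm{gl.GID}_{(\mathcal{FP}\mathrm{Inj}(R),\mathrm{Inj}(R))}(R)$; when they coincide the common value is denoted $\mathrm{gl.D.dim}(R)$. $\mathrm{gl.GP}(R)=\mathrm{gl.GPD}_{(\mathrm{Proj}(R),\mathrm{Proj}(R))}(R)$ and $\mathrm{gl.GI}(R)=\mathrm{gl.GID}_{(\mathrm{Inj}(R),\mathrm{Inj}(R))}(R)$; these coincide for every ring (Bennis–Mahdou) and the common value is denoted $\mathrm{gl.G.dim}(R)$. *)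

(* Defs.v *)
From HB Require Import structures.
From mathcomp Require Import all_boot all_order all_algebra.
From mathcomp Require Import boolp classical_sets constructive_ereal.

Set Implicit Arguments.
Unset Strict Implicit.
Unset Printing Implicit Defensive.

Import Order.TTheory GRing.Theory Num.Theory.
Local Open Scope ring_scope.

(* pzRingType allows the zero ring. A class of modules is a predicate on
   lmodType R rather than a [set (lmodType R)]: the latter would force the
   universe of [set] above that of module carriers, so that no set of subsets
   of a module could itself carry a module structure. *)
Definition module_class (R : pzRingType) := lmodType R -> Prop.

Definition surjective_map (A B : Type) (f : A -> B) :=
  forall y : B, exists x : A, f x = y.

Definition exact_at (A B C : nmodType) (f : A -> B) (g : B -> C) :=
  forall y : B, g y = 0 <-> exists x : A, f x = y.

Definition is_zero_module (R : pzRingType) (M : lmodType R) :=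
  forall x : M, x = 0.

(* ... -> P 2 -> P 1 -> P 0 -> M -> 0 *)
Record resolution (R : pzRingType) (M : lmodType R) := Resolution {
  res_obj :> nat -> lmodType R;
  res_diff : forall i : nat, {linear res_obj i.+1 -> res_obj i};
  res_aug : {linear res_obj 0%N -> M};
  res_aug_surj : surjective_map res_aug;
  res_exact0 : exact_at (res_diff 0%N) res_aug;
  res_exact : forall i : nat, exact_at (res_diff i.+1) (res_diff i)
}.

(* 0 -> M -> E 0 -> E 1 -> E 2 -> ... *)
Record coresolution (R : pzRingType) (M : lmodType R) := Coresolution {
  cores_obj :> nat -> lmodType R;
  cores_diff : forall i : nat, {linear cores_obj i -> cores_obj i.+1};
  cores_aug : {linear M -> cores_obj 0%N};
  cores_aug_inj : injective cores_aug;
  cores_exact0 : exact_at cores_aug (cores_diff 0%N);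
  cores_exact : forall i : nat, exact_at (cores_diff i) (cores_diff i.+1)
}.

Definition has_resolution_of_length (R : pzRingType) (C : module_class R)
    (M : lmodType R) (n : nat) :=
  exists G : resolution M,
    (forall i : nat, (i <= n)%N -> C (G i)) /\
    (forall i : nat, (n < i)%N -> is_zero_module (G i)).

Definition has_coresolution_of_length (R : pzRingType) (C : module_class R)
    (M : lmodType R) (n : nat) :=
  exists E : coresolution M,
    (forall i : nat, (i <= n)%N -> C (E i)) /\
    (forall i : nat, (n < i)%N -> is_zero_module (E i)).

(* Dimensions live in \bar int; only values n%:Z%:E and +oo are taken (and -oo
   for the supremum of an empty class). *)
Definition least_length (P : nat -> Prop) : \bar int :=
  infimum +oo%E [set x : \bar int | exists2 n : nat, P n & x = (n%:Z)%:E].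

Definition sup_over (R : pzRingType) (C : module_class R)
    (dim : lmodType R -> \bar int) : \bar int :=
  supremum -oo%E [set x : \bar int | exists2 M : lmodType R, C M & x = dim M].

Definition resolution_dim (R : pzRingType) (C : module_class R)
    (M : lmodType R) : \bar int :=
  least_length (has_resolution_of_length C M).

Definition coresolution_dim (R : pzRingType) (C : module_class R)
    (M : lmodType R) : \bar int :=
  least_length (has_coresolution_of_length C M).

Definition AllModules (R : pzRingType) : module_class R := fun=> True.

Definition Proj (R : pzRingType) : module_class R := fun P =>
  forall (B C : lmodType R) (g : {linear B -> C}) (f : {linear P -> C}),
    surjective_map g -> exists h : {linear P -> B}, forall x, g (h x) = f x.

Definition Inj (R : pzRingType) : module_class R := fun E =>
  forall (A B : lmodType R) (g : {linear A -> B}) (f : {linear A -> E}),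
    injective g -> exists h : {linear B -> E}, forall x, h (g x) = f x.

(* Right R-modules are left modules over the converse ring R^c: the right
   action a . r is ((r : R^c) *: a). *)
Definition balanced (R : pzRingType) (A : lmodType R^c) (M : lmodType R)
    (T : zmodType) (b : A -> M -> T) :=
  [/\ forall a a' m, b (a + a') m = b a m + b a' m,
      forall a m m', b a (m + m') = b a m + b a m' &
      forall (r : R) a m, b ((r : R^c) *: a) m = b a (r *: m)].

(* (T, t) is a tensor product of A and M over R, by its universal property. *)
Definition is_tensor_product (R : pzRingType) (A : lmodType R^c)
    (M : lmodType R) (T : zmodType) (t : A -> M -> T) :=
  balanced t /\
  forall (U : zmodType) (b : A -> M -> U), balanced b ->
    exists h : {additive T -> U},
      (forall a m, h (t a m) = b a m) /\
      (forall h' : {additive T -> U}, (forall a m, h' (t a m) = b a m) ->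
        h' =1 h).

(* The map h below is f tensor M. *)
Definition Flat (R : pzRingType) : module_class R := fun M =>
  forall (A B : lmodType R^c) (f : {linear A -> B}), injective f ->
  forall (TA TB : zmodType) (tA : A -> M -> TA) (tB : B -> M -> TB),
    is_tensor_product tA -> is_tensor_product tB ->
  forall h : {additive TA -> TB},
    (forall a m, h (tA a m) = tB (f a) m) -> injective h.

(* R^m -> R^n -> N -> 0 exact *)
Definition finitely_presented (R : pzRingType) : module_class R := fun N =>
  exists (m n : nat) (d : {linear 'rV[R]_m -> 'rV[R]_n})
         (p : {linear 'rV[R]_n -> N}),
    exact_at d p /\ surjective_map p.

(* H^1 (Hom (P, M)) = 0 for every projective resolution P of N *)
Definition Ext1_vanishes (R : pzRingType) (N M : lmodType R) :=
  forall P : resolution N, (forall i, Proj (P i)) ->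
  forall f : {linear P 1%N -> M}, (forall x, f (res_diff P 1%N x) = 0) ->
  exists g : {linear P 0%N -> M}, forall x, f x = g (res_diff P 0%N x).

Definition FPInj (R : pzRingType) : module_class R := fun M =>
  forall N : lmodType R, finitely_presented N -> Ext1_vanishes N M.

Definition pd_class (R : pzRingType) (C : module_class R) : \bar int :=
  sup_over C (resolution_dim (@Proj R)).

Definition id_class (R : pzRingType) (C : module_class R) : \bar int :=
  sup_over C (coresolution_dim (@Inj R)).

(* Homological indexing ... -> X (i + 1) -> X i -> ...; every integer is of
   the form i + 1, so conditions at X (i + 1) for all i cover the complex. *)
Record exact_complex (R : pzRingType) := ExactComplex {
  cpx_obj :> int -> lmodType R;
  cpx_diff : forall i : int, {linear cpx_obj (i + 1) -> cpx_obj i};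
  cpx_exact : forall i : int, exact_at (cpx_diff (i + 1)) (cpx_diff i)
}.

(* M is isomorphic to the kernel of some differential of X. *)
Definition is_cycle_of (R : pzRingType) (X : exact_complex R)
    (M : lmodType R) :=
  exists (i : int) (e : {linear M -> X (i + 1)}),
    injective e /\ exact_at e (cpx_diff X i).

Definition Hom_from_exact (R : pzRingType) (X : exact_complex R)
    (Y : lmodType R) :=
  forall (i : int) (f : {linear X (i + 1) -> Y}),
    (forall x, f (cpx_diff X (i + 1) x) = 0) ->
    exists g : {linear X i -> Y}, forall x, f x = g (cpx_diff X i x).

Definition Hom_to_exact (R : pzRingType) (X : lmodType R)
    (Y : exact_complex R) :=
  forall (i : int) (f : {linear X -> Y (i + 1)}),
    (forall x, cpx_diff Y i (f x) = 0) ->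
    exists g : {linear X -> Y (i + 1 + 1)},
      forall x, f x = cpx_diff Y (i + 1) (g x).

Definition GProj (R : pzRingType) (X Y : module_class R) : module_class R :=
  fun M => exists P : exact_complex R,
    [/\ forall i : int, X (P i),
        forall N : lmodType R, Y N -> Hom_from_exact P N &
        is_cycle_of P M].

Definition GInj (R : pzRingType) (X Y : module_class R) : module_class R :=
  fun M => exists E : exact_complex R,
    [/\ forall i : int, Y (E i),
        forall N : lmodType R, X N -> Hom_to_exact N E &
        is_cycle_of E M].

Definition glGPD (R : pzRingType) (X Y : module_class R) : \bar int :=
  sup_over (@AllModules R) (resolution_dim (GProj X Y)).

Definition glGID (R : pzRingType) (X Y : module_class R) : \bar int :=
  sup_over (@AllModules R) (coresolution_dim (GInj X Y)).

Definition glDP (R : pzRingType) := glGPD (@Proj R) (@Flat R).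
Definition glDI (R : pzRingType) := glGID (@FPInj R) (@Inj R).
Definition glGP (R : pzRingType) := glGPD (@Proj R) (@Proj R).
Definition glGI (R : pzRingType) := glGID (@Inj R) (@Inj R).

(* Main.v *)
(* As id(Proj) is finite, shifting along an exact complex of projectives shows
   that its cycles have no Ext into modules of finite projective dimension;
   dually, modules of finite projective dimension have no Ext into cycles of
   an exact complex of injectives.  So the Hom-exactness conditions defining
   GP_(Proj, Y) and GI_(X, Inj) are automatic once the modules of Y and X have
   finite projective dimension, and these classes do not depend on Y and X.
   For X = FPInj this is the hypothesis.

   For Y = Flat, write F = P/K with P free.  Flatness makes K locally a retract
   of P, so that every finite subset of K lies in a countably generated
   projective submodule, which can be chosen monotonically.  Modules of finite
   projective dimension have bounded projective dimension, so they satisfy two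
   out of three and are closed under unions of chains; transfinite induction
   along a well-ordering of K then gives pd(K) finite.

   Finally gl.GP <= k iff pd(Inj) <= k, iff id(Proj) <= k, iff gl.GI <= k: if
   pd(Inj) <= k then an embedding M -> E of M in an injective induces, on k-th
   syzygies, an embedding in a projective, so that k-th syzygies are cycles of
   exact complexes of projectives. *)
From HB Require Import structures.
From mathcomp Require Import all_boot all_order all_algebra.
From mathcomp Require Import boolp classical_sets functions wochoice.
From mathcomp Require Import constructive_ereal.
(* Required after [functions], which exports an abbreviation [Inj]. *)
Require Import Defs.

Set Implicit Arguments.
Unset Strict Implicit.
Unset Printing Implicit Defensive.

Import Order.TTheory GRing.Theory Num.Theory.
Local Open Scope ring_scope.

(** * Linear maps, submodules and quotients *)

(** Ext is never built as a group: [Ext1 M N] says that maps into [N] extend along every sequence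
    ending in [M], and higher degrees replace [M] by an iterated syzygy or, equivalently, [N] by an
    iterated cosyzygy. This is why enough injectives are constructed.

    The obstacle is the flat case, because in general a union of a chain of submodules of pd at most
    k can have larger pd. Here a uniform bound prevents this. If M has finite pd d, then Ext^d(M, -)
    is right exact, hence nonzero on some free module; as id(Proj) <= n, this forces d <= n. So the
    quotient of two members of a chain again has pd at most n, and a lift given on the smaller
    member extends to the larger one.

    The chains in K come from initial segments of a well-ordering by a closure operator. It adds to
    each finite set finitely many generators of the image of a map P -> K that fixes this set; this
    makes closures of finite sets projective. *)

Section LinearMaps.
Variable R : pzRingType.
Implicit Types A B C X : lmodType R.

Definition mklin A B (f : A -> B) (lf : linear f) : {linear A -> B} :=
  HB.pack f (GRing.isLinear.Build R A B *:%R f lf).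

(** Maps chosen value by value need not be linear. A relation closed under combinations is
    single-valued as soon as it is so at 0, by subtraction, and then its choice function is
    linear. *)
Lemma lin_of_rel A B (r : A -> B -> Prop) :
  (forall x, exists y, r x y) ->
  (forall a x y x' y', r x y -> r x' y' -> r (a *: x + x') (a *: y + y')) ->
  (forall y, r 0 y -> y = 0) ->
  exists h : {linear A -> B}, forall x y, r x y <-> y = h x.
Proof.
move=> tot clos fun0.
have func x y y' : r x y -> r x y' -> y' = y.
  move=> rxy rxy'; apply/subr0_eq/fun0.
  by have := clos (-1) _ _ _ _ rxy rxy'; rewrite !scaleN1r addNr addrC.
pose f x := projT1 (cid (tot x)).
have fP x : r x (f x) by rewrite /f; case: cid.
have lf : linear f.
  by move=> a x x'; apply: func (fP _); apply: clos.
exists (mklin lf) => x y; split=> [rxy|->]; last exact: fP.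
exact: func (fP x) rxy.
Qed.

Definition ses A B C (i : {linear A -> B}) (p : {linear B -> C}) :=
  [/\ injective i, exact_at i p & surjective_map p].

Lemma lin_inj A B (f : {linear A -> B}) :
  (forall x, f x = 0 -> x = 0) -> injective f.
Proof. by move=> h x y e; apply/subr0_eq/h; rewrite linearB e subrr. Qed.

Lemma ses_comp0 A B C (i : {linear A -> B}) (p : {linear B -> C}) x :
  exact_at i p -> p (i x) = 0.
Proof. by move=> h; apply/h; exists x. Qed.

Lemma factor_ker X A B C (i : {linear A -> B}) (p : {linear B -> C})
    (f : {linear X -> B}) :
  injective i -> exact_at i p -> (forall x, p (f x) = 0) ->
  exists h : {linear X -> A}, forall x, i (h x) = f x.
Proof.
move=> inji ex pf0.
have [x|a x y x' y' e e'|y|h hP] := @lin_of_rel X A (fun x y => i y = f x).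
- by have [y yP] := (ex (f x)).1 (pf0 x); exists y.
- by rewrite !linearP e e'.
- by rewrite linear0 => e; apply: inji; rewrite linear0.
- by exists h => x; apply/hP.
Qed.

Lemma factor_coker A B C X (i : {linear A -> B}) (p : {linear B -> C})
    (f : {linear B -> X}) :
  surjective_map p -> exact_at i p -> (forall x, f (i x) = 0) ->
  exists h : {linear C -> X}, forall x, h (p x) = f x.
Proof.
move=> sp ex fi0.
have [x|a x y x' y' [b [<- <-]] [b' [<- <-]]|y|h hP] :=
  @lin_of_rel C X (fun x y => exists b, p b = x /\ f b = y).
- by have [b <-] := sp x; exists (f b), b.
- by exists (a *: b + b'); rewrite !linearP.
- by case=> b [/ex [a <-] <-].
- by exists h => x; apply/esym/hP; exists x.
Qed.

End LinearMaps.

Section Submodule.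
Variables (R : pzRingType) (A : lmodType R).

Record submod := Submod {
  submod_mem :> A -> Prop;
  submod0 : submod_mem 0;
  submodP : forall a x y,
    submod_mem x -> submod_mem y -> submod_mem (a *: x + y)
}.

Variable S : submod.

Lemma submodD x y : S x -> S y -> S (x + y).
Proof. by move=> Sx Sy; rewrite -[x]scale1r; apply: submodP. Qed.
Lemma submodZ a x : S x -> S (a *: x).
Proof. by move=> Sx; rewrite -[_ *: _]addr0; apply: submodP (submod0 S). Qed.
Lemma submodN x : S x -> S (- x).
Proof. by rewrite -scaleN1r; apply: submodZ. Qed.
Lemma submodB x y : S x -> S y -> S (x - y).
Proof. by move=> Sx Sy; apply: submodD => //; apply: submodN. Qed.
Lemma submod_sum I (s : seq I) (F : I -> A) :
  (forall i, S (F i)) -> S (\sum_(i <- s) F i).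
Proof.
by move=> SF; elim/big_rec: _ => [|i x _]; [apply: submod0|apply: submodD].
Qed.

Definition submod_pred : pred A := fun x => `[<S x>].
Definition submod_type := {x : A | submod_pred x}.
HB.instance Definition _ := [isSub of submod_type for @sval _ _].
HB.instance Definition _ := [Choice of submod_type by <:].

Lemma submod_pred_closed : GRing.submod_closed submod_pred.
Proof.
split=> [|a x y /asboolP Sx /asboolP Sy]; first exact/asboolP/submod0.
exact/asboolP/submodP.
Qed.

HB.instance Definition _ :=
  GRing.SubChoice_isSubLmodule.Build R A submod_pred submod_type
    submod_pred_closed.

Definition submod_lmod : lmodType R := submod_type.

Lemma submod_incl_subproof :
  exists f : {linear submod_lmod -> A}, forall x, f x = val x.
Proof. by exists \val. Qed.

(** Taken through [cid] so that it does not reduce to [val] under simplification. *)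
Definition submod_incl : {linear submod_lmod -> A} :=
  projT1 (cid submod_incl_subproof).

Lemma submod_incl_val (x : submod_lmod) : submod_incl x = val x.
Proof. exact: (projT2 (cid submod_incl_subproof)). Qed.

Lemma submod_incl_inj : injective submod_incl.
Proof. by move=> x y; rewrite !submod_incl_val => /val_inj. Qed.

Lemma submod_inclP (x : submod_lmod) : S (submod_incl x).
Proof. by rewrite submod_incl_val; apply/asboolP/(valP x). Qed.

Lemma submod_inclE (x : A) : S x -> exists y, submod_incl y = x.
Proof.
move=> Sx; exists (exist (fun y => submod_pred y) x (introT (asboolP _) Sx)).
by rewrite submod_incl_val.
Qed.

End Submodule.

Section Kernel.
Variables (R : pzRingType) (A B : lmodType R) (f : {linear A -> B}).

Definition kernel : submod A.
Proof.
exists (fun x => f x = 0) => [|a x y fx fy]; first exact: linear0.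
by rewrite linearP fx fy scaler0 addr0.
Defined.

Lemma kernel_exact : exact_at (submod_incl kernel) f.
Proof.
by move=> y; split=> [/(@submod_inclE _ _ kernel)|[x <-]]; last exact: (submod_inclP x).
Qed.

Definition range_submod : submod B.
Proof.
exists (fun y => exists x, f x = y) => [|a _ _ [x <-] [y <-]].
  by exists 0; rewrite linear0.
by exists (a *: x + y); rewrite linearP.
Defined.

End Kernel.

Definition mkadd (A B : zmodType) (f : A -> B) (af : zmod_morphism f) :
  {additive A -> B} := HB.pack f (GRing.isZmodMorphism.Build A B f af).

(** Quotients are built for groups before modules, since Q/Z and the tensor product [col_tensor] are
    quotients of groups only. *)
Record subgrp (A : zmodType) := Subgrp {
  subgrp_mem :> A -> Prop;
  subgrp0 : subgrp_mem 0;
  subgrpB : forall x y, subgrp_mem x -> subgrp_mem y -> subgrp_mem (x - y)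
}.

Section ZmodQuotient.
Variables (A : zmodType) (S : subgrp A).

Local Lemma SN x : S x -> S (- x).
Proof. by move=> Sx; rewrite -[- x]add0r; apply: subgrpB => //; apply: subgrp0. Qed.
Local Lemma SD x y : S x -> S y -> S (x + y).
Proof. by move=> Sx Sy; rewrite -[y]opprK; apply: subgrpB => //; apply: SN. Qed.

(* A canonical representative of each coset; these carry the quotient. *)
Definition quo_repr (x : A) : A := choose (fun y => `[<S (x - y)>]) x.

Lemma quo_reprP x : S (x - quo_repr x).
Proof.
apply/asboolP/(@chooseP _ (fun y => `[<S (x - y)>])).
by rewrite subrr; apply/asboolP/subgrp0.
Qed.

Lemma quo_repr_eq x y : S (x - y) -> quo_repr x = quo_repr y.
Proof.
move=> Sxy; rewrite /quo_repr.
have e : (fun z => `[<S (x - z)>]) =1 (fun z => `[<S (y - z)>]).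
  move=> z; apply/asboolP/asboolP=> h.
    by have := subgrpB h Sxy; rewrite opprB addrC addrA subrK.
  by have := SD Sxy h; rewrite addrA subrK.
rewrite (eq_choose e); apply: choose_id; apply/asboolP.
  by rewrite -opprB; apply: SN.
by rewrite subrr; apply: subgrp0.
Qed.

Lemma quo_repr_id x : quo_repr (quo_repr x) = quo_repr x.
Proof. by apply: quo_repr_eq; rewrite -opprB; apply/SN/quo_reprP. Qed.

Definition quo_type := {x : A | quo_repr x == x}.
HB.instance Definition _ := [isSub of quo_type for @sval _ _].
HB.instance Definition _ := [Choice of quo_type by <:].

Definition quo_pi (x : A) : quo_type :=
  exist _ (quo_repr x) (introT eqP (quo_repr_id x)).

Lemma quo_piP x y : quo_pi x = quo_pi y <-> S (x - y).
Proof.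
split=> [[e]|Sxy]; last exact/val_inj/quo_repr_eq.
have := subgrpB (quo_reprP x) (quo_reprP y).
by rewrite e opprB addrA subrK.
Qed.

Lemma quo_pi_val u : quo_pi (val u) = u.
Proof. by apply/val_inj/eqP/(valP u). Qed.

Lemma quo_val_pi x : S (val (quo_pi x) - x).
Proof. by rewrite -opprB; apply/SN/quo_reprP. Qed.

Definition quo_add (u v : quo_type) := quo_pi (val u + val v).
Definition quo_opp (u : quo_type) := quo_pi (- val u).

Lemma quo_addE x y : quo_add (quo_pi x) (quo_pi y) = quo_pi (x + y).
Proof. by apply/quo_piP; rewrite opprD addrACA; apply: SD; apply: quo_val_pi. Qed.
Lemma quo_oppE x : quo_opp (quo_pi x) = quo_pi (- x).
Proof. by apply/quo_piP; rewrite -opprD; apply/SN/quo_val_pi. Qed.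

Lemma quo_addA : associative quo_add.
Proof.
move=> u v w; rewrite -(quo_pi_val u) -(quo_pi_val v) -(quo_pi_val w).
by rewrite !quo_addE addrA.
Qed.
Lemma quo_addC : commutative quo_add.
Proof. by move=> u v; rewrite /quo_add addrC. Qed.
Lemma quo_add0 : left_id (quo_pi 0) quo_add.
Proof. by move=> u; rewrite -(quo_pi_val u) quo_addE add0r. Qed.
Lemma quo_addN : left_inverse (quo_pi 0) quo_opp quo_add.
Proof. by move=> u; rewrite -(quo_pi_val u) quo_oppE quo_addE addNr. Qed.

HB.instance Definition _ :=
  GRing.isZmodule.Build quo_type quo_addA quo_addC quo_add0 quo_addN.

Lemma quo_pi_additive : zmod_morphism quo_pi.
Proof.
move=> x y; apply/esym; change (quo_add (quo_pi x) (quo_opp (quo_pi y)) = quo_pi (x - y)).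
by rewrite quo_oppE quo_addE.
Qed.

HB.instance Definition _ :=
  GRing.isZmodMorphism.Build A quo_type quo_pi quo_pi_additive.

Lemma quo_pi_eq0 x : quo_pi x = 0 <-> S x.
Proof. by rewrite -{2}[x]subr0; apply: quo_piP. Qed.

Lemma quo_pi_surj u : exists x, quo_pi x = u.
Proof. by exists (val u); apply: quo_pi_val. Qed.

Lemma quo_additive (U : zmodType) (f : {additive A -> U}) :
  (forall x, S x -> f x = 0) ->
  exists h : {additive quo_type -> U}, forall x, h (quo_pi x) = f x.
Proof.
move=> fS; pose g (u : quo_type) := f (val u).
have gE x : g (quo_pi x) = f x.
  by apply/subr0_eq; rewrite -raddfB; apply/fS/quo_val_pi.
have ag : zmod_morphism g.
  move=> u v; rewrite -(quo_pi_val u) -(quo_pi_val v) -raddfB !gE.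
  exact: raddfB.
by exists (mkadd ag).
Qed.

End ZmodQuotient.

Section Quotient.
Variables (R : pzRingType) (A : lmodType R) (S : submod A).

Definition submod_subgrp := Subgrp (submod0 S) (@submodB R A S).
Definition quo := quo_type submod_subgrp.
HB.instance Definition _ := GRing.Zmodule.on quo.

Definition quo_scale (a : R) (u : quo) : quo := quo_pi submod_subgrp (a *: val u).

Local Notation pi x := (quo_pi submod_subgrp x : quo).

Lemma quo_scaleE a x : quo_scale a (pi x) = pi (a *: x).
Proof. by apply/quo_piP; rewrite -scalerBr; apply/submodZ/quo_val_pi. Qed.

Lemma quo_scaleA a b v : quo_scale a (quo_scale b v) = quo_scale (a * b) v.
Proof. by rewrite -(quo_pi_val v) !quo_scaleE scalerA. Qed.
Lemma quo_scale1 : left_id 1 quo_scale.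
Proof. by move=> v; rewrite -(quo_pi_val v) !quo_scaleE scale1r. Qed.
Lemma quo_scaleDr : right_distributive quo_scale +%R.
Proof.
move=> a u v; rewrite -(quo_pi_val u) -(quo_pi_val v).
by rewrite -raddfD !quo_scaleE scalerDr raddfD.
Qed.
Lemma quo_scaleDl v : {morph quo_scale^~ v : a b / a + b}.
Proof.
by move=> a b; rewrite -(quo_pi_val v) !quo_scaleE scalerDl raddfD.
Qed.

HB.instance Definition _ := GRing.Zmodule_isLmodule.Build R quo
  quo_scaleA quo_scale1 quo_scaleDr quo_scaleDl.

Lemma quo_proj_linear : linear (fun x => pi x).
Proof.
move=> a x y; change (pi (a *: x + y) = quo_scale a (pi x) + pi y).
by rewrite quo_scaleE; apply: raddfD.
Qed.

Lemma quo_proj_subproof :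
  exists f : {linear A -> quo}, (forall x, f x = 0 <-> S x) /\ surjective_map f.
Proof.
exists (mklin quo_proj_linear); split=> [x|u]; first exact: quo_pi_eq0.
exact: quo_pi_surj.
Qed.

Definition quo_proj : {linear A -> quo} := projT1 (cid quo_proj_subproof).

Lemma quo_proj_eq0 x : quo_proj x = 0 <-> S x.
Proof. by have [+ _] := projT2 (cid quo_proj_subproof); apply. Qed.

Lemma quo_proj_surj : surjective_map quo_proj.
Proof. exact: (projT2 (cid quo_proj_subproof)).2. Qed.

End Quotient.

(** * Free modules *)

Section Free.
Variables (R : pzRingType) (T : choiceType).

Definition free_submod : submod (T -> R^o).
Proof.
exists (fun f => exists s : seq T, forall t, t \notin s -> f t = 0).
  by exists [::].
move=> a f g [s fs] [s' gs']; exists (s ++ s') => t.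
rewrite mem_cat negb_or => /andP[/fs ft /gs' gt].
by change (a * f t + g t = 0); rewrite ft gt mulr0 addr0.
Defined.

Definition free : lmodType R := submod_lmod free_submod.

Definition free_coef (x : free) (t : T) : R := submod_incl free_submod x t.

Lemma free_coefP a x y t :
  free_coef (a *: x + y) t = a * free_coef x t + free_coef y t.
Proof. by rewrite /free_coef linearP. Qed.

Lemma free_supp x : exists2 s, uniq s & forall t, t \notin s -> free_coef x t = 0.
Proof.
have [s sP] := submod_inclP x; exists (undup s); first exact: undup_uniq.
by move=> t; rewrite mem_undup; apply: sP.
Qed.

Lemma free_delta_subproof t :
  free_submod (fun u => if u == t then 1 else 0 : R^o).
Proof. by exists [:: t] => u; rewrite inE => /negPf->. Qed.

Definition free_delta t : free :=
  projT1 (cid (submod_inclE (free_delta_subproof t))).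

Lemma free_coef_delta t u : free_coef (free_delta t) u = (u == t)%:R.
Proof. by rewrite /free_coef /free_delta; case: cid => x /= ->; case: eqP. Qed.

Lemma free_coef_inj x y : free_coef x =1 free_coef y -> x = y.
Proof. by move=> e; apply/submod_incl_inj/funext/e. Qed.

Lemma free_coef_sum I (r : seq I) (F : I -> free) t :
  free_coef (\sum_(i <- r) F i) t = \sum_(i <- r) free_coef (F i) t.
Proof.
rewrite /free_coef raddf_sum /=.
by elim/big_rec2: _ => // i y1 y2 _ <-.
Qed.

Lemma free_coefZ a x t : free_coef (a *: x) t = a * free_coef x t.
Proof. by rewrite /free_coef linearZ. Qed.

Lemma free_sum_supp (B : lmodType R) (b : T -> B) x s s' :
  uniq s -> uniq s' -> {subset s <= s'} ->
  (forall t, t \notin s -> free_coef x t = 0) ->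
  \sum_(t <- s') free_coef x t *: b t = \sum_(t <- s) free_coef x t *: b t.
Proof.
move=> us us' ss' xs; rewrite (bigID (mem s)) /= addrC big1 ?add0r; last first.
  by move=> t ts; rewrite xs ?scale0r.
rewrite -big_filter; apply/perm_big/uniq_perm => //; first exact: filter_uniq.
by move=> t; rewrite mem_filter; apply: andb_idr => /ss'.
Qed.

Lemma free_decomp x s : uniq s -> (forall t, t \notin s -> free_coef x t = 0) ->
  x = \sum_(t <- s) free_coef x t *: free_delta t.
Proof.
move=> us xs; apply: free_coef_inj => u; rewrite free_coef_sum.
under eq_bigr do rewrite free_coefZ free_coef_delta.
have [us'|us'] := boolP (u \in s).
  rewrite (big_rem u) //= eqxx mulr1 big_seq big1 ?addr0 // => t.
  rewrite mem_rem_uniq // inE eq_sym => /andP[/negPf-> _].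
  by rewrite mulr0.
rewrite xs // big_seq big1 // => t ts; rewrite (_ : u == t = false) ?mulr0 //.
by apply: contraNF us' => /eqP->.
Qed.

Lemma free_ext (B : lmodType R) (b : T -> B) :
  exists h : {linear free -> B}, forall t, h (free_delta t) = b t.
Proof.
(* Any list containing the support is allowed, so that two elements can be expanded over a common
   list. *)
pose r x y := exists s, [/\ uniq s, forall t, t \notin s -> free_coef x t = 0 &
                         y = \sum_(t <- s) free_coef x t *: b t].
have [x|a x y x' y' [s [us xs ->]] [s' [us' xs' ->]]|y [s [_ _ ->]]|h hP] :=
  @lin_of_rel R free B r.
- have [s us xs] := free_supp x.
  by exists (\sum_(t <- s) free_coef x t *: b t), s.
- exists (undup (s ++ s')); split; first exact: undup_uniq.
    move=> t; rewrite mem_undup mem_cat negb_or => /andP[/xs xt /xs' xt'].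
    by rewrite free_coefP xt xt' mulr0 addr0.
  rewrite -(@free_sum_supp B b x s (undup (s ++ s'))) ?undup_uniq //; last first.
    by move=> t ts; rewrite mem_undup mem_cat ts.
  rewrite -(@free_sum_supp B b x' s' (undup (s ++ s'))) ?undup_uniq //; last first.
    by move=> t ts; rewrite mem_undup mem_cat ts orbT.
  rewrite scaler_sumr -big_split /=; apply: eq_bigr => t _.
  by rewrite free_coefP scalerDl scalerA.
- rewrite big1 // => t _.
  by rewrite /free_coef linear0 scale0r.
exists h => t; apply/esym/hP; exists [:: t]; split=> // [u|].
  by rewrite inE free_coef_delta => /negPf->.
by rewrite big_seq1 free_coef_delta eqxx scale1r.
Qed.

Lemma free_eq_lin (B : lmodType R) (f g : {linear free -> B}) :
  (forall t, f (free_delta t) = g (free_delta t)) -> f =1 g.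
Proof.
move=> fg x; have [s us xs] := free_supp x.
rewrite (free_decomp us xs) !linear_sum; apply: eq_bigr => t _.
by rewrite !linearZ fg.
Qed.

Lemma free_proj : Proj free.
Proof.
move=> B C g f sg.
have [b bP] := choice (fun t => sg (f (free_delta t))).
have [h hP] := free_ext b; exists h.
by apply: (free_eq_lin (f := g \o h)) => t /=; rewrite hP.
Qed.

End Free.

Section Cover.
Variables (R : pzRingType) (M : lmodType R).

Definition cover : {linear free R M -> M} := projT1 (cid (free_ext (@idfun M))).

Lemma cover_delta m : cover (free_delta R m) = m.
Proof. by rewrite /cover; case: cid => h /= ->. Qed.

Lemma cover_surj : surjective_map cover.
Proof. by move=> m; exists (free_delta R m); apply: cover_delta. Qed.

Definition syz : lmodType R := submod_lmod (kernel cover).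

Lemma syz_ses : ses (submod_incl (kernel cover)) cover.
Proof.
split; [exact: submod_incl_inj|exact: kernel_exact|exact: cover_surj].
Qed.

End Cover.

(** * Enough injectives *)

Local Open Scope classical_set_scope.

(** [Zorn_bigcup] also asks for the union of the empty chain. The empty set is therefore adjoined to
    the predicate; maximality excludes it afterwards unless [G0] is itself empty. *)
Lemma Zorn_above T (P : set (set T)) (G0 : set T) :
  P G0 ->
  (forall F : set (set T), F `<=` P -> F !=set0 -> total_on F subset ->
    P (\bigcup_(X in F) X)) ->
  exists2 G, P G /\ G0 `<=` G & forall H, P H -> G `<=` H -> H `<=` G.
Proof.
move=> PG0 Pcup.
have [F FQ totF|A [QA Amax]] :=
    @Zorn_bigcup T [set A | A = set0 \/ P A /\ G0 `<=` A].
  have [[X [FX X0]]|noX] := pselect (exists X, F X /\ X <> set0); last first.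
    left; apply/seteqP; split=> // x [X FX Xx].
    have [X0|[_ _]] := FQ X FX; first by rewrite X0 in Xx.
    by case: noX; exists X; split=> // X0; rewrite X0 in Xx.
  pose F' := [set Y | F Y /\ Y <> set0].
  have -> : \bigcup_(X in F) X = \bigcup_(X in F') X.
    apply/seteqP; split=> x [Y FY Yx]; last by exists Y => //; case: FY.
    by exists Y => //; split=> // Y0; rewrite Y0 in Yx.
  have FP Y : F' Y -> P Y /\ G0 `<=` Y by case=> /FQ[].
  right; split.
    apply: Pcup => [Y /FP[]//||Y Z [FY _] [FZ _]]; last exact: totF.
    by exists X.
  by move=> x G0x; exists X => //; have [_] := FP X (conj FX X0); apply.
have AG0 : P A /\ G0 `<=` A.
  case: QA => // A0; have [G00|G00] := pselect (G0 = set0).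
    by rewrite A0 -{1}G00; split=> //; rewrite G00.
  case: (Amax G0); last by right; split.
  by rewrite A0; split=> // /(_ _ _)-sub; apply: G00; apply/seteqP; split.
exists A => // H PH AH; apply: contrapT => HA.
by case: (Amax H) => //; right; split=> //; apply: subset_trans AH; case: AG0.
Qed.

(** * Divisible groups and Q/Z *)

Definition divisible (D : zmodType) := forall n (d : D), exists e, e *+ n.+1 = d.

Section Divisible.
Variables (B D : zmodType).
Hypothesis divD : divisible D.

(** Graphs of additive maps from a subgroup of [B] to [D], so that extension of maps becomes
    inclusion of sets. *)
Definition partial_additive (G : set (B * D)) :=
  [/\ G (0, 0),
      forall x y x' y', G (x, y) -> G (x', y') -> G (x - x', y - y') &
      forall y, G (0, y) -> y = 0].

Section PartialAdditive.
Variables (G : set (B * D)) (paG : partial_additive G).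

Lemma padd_opp x y : G (x, y) -> G (- x, - y).
Proof. by have [G0 GB _] := paG => /(GB _ _ _ _ G0); rewrite !sub0r. Qed.

Lemma padd_add x y x' y' : G (x, y) -> G (x', y') -> G (x + x', y + y').
Proof.
have [_ GB _] := paG => Gx /padd_opp/(GB _ _ _ _ Gx).
by rewrite !opprK.
Qed.

Lemma padd_muln n x y : G (x, y) -> G (x *+ n, y *+ n).
Proof.
move=> Gx; elim: n => [|n IHn]; first by rewrite !mulr0n; case: paG.
by rewrite !mulrS; apply: padd_add.
Qed.

Lemma padd_fun x y y' : G (x, y) -> G (x, y') -> y' = y.
Proof.
have [_ GB G0] := paG => Gx Gx'; apply/subr0_eq/G0.
by rewrite -(subrr x); apply: GB.
Qed.

(** The integers k with k b in the domain form a subgroup of Z, generated by its least positive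
    element [n.+1] if there is one. Then [e] is the value at n.+1 times b, divided by [n.+1];
    otherwise [e] = 0 works. *)
Lemma padd_extend_elt (b : B) :
  exists e, forall (k : int) y, G (b *~ k, y) -> y = e *~ k.
Proof.
suff [e eP] : exists e, forall n y, G (b *+ n, y) -> y = e *+ n.
  exists e => -[n|n] y; first exact: eP.
  by rewrite !NegzE !mulrNz -!pmulrn => /padd_opp; rewrite opprK => /eP <-; rewrite opprK.
have [_ _ G0] := paG.
have [ex|nex] := pselect (exists n, `[< (0 < n)%N /\ exists d, G (b *+ n, d) >]);
    last first.
  exists 0 => -[|n] y; first by rewrite !mulr0n; apply: G0.
  by move=> Gy; case: nex; exists n.+1; apply/asboolP; split=> //; exists y.
case: (ex_minnP ex) => -[|n] /asboolP[] // _ [d Gd] nmin.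
have [e eP] := divD n d; exists e => k y.
have -> : b *+ k = b *+ n.+1 *+ (k %/ n.+1) + b *+ (k %% n.+1).
  by rewrite -mulrnA -mulrnDr mulnC -divn_eq.
move=> Gk.
have Gr : G (b *+ (k %% n.+1), y - d *+ (k %/ n.+1)).
  have := padd_add Gk (padd_opp (padd_muln (k %/ n.+1) Gd)).
  by rewrite addrAC subrr add0r.
have r0 : (k %% n.+1)%N = 0%N.
  apply/eqP; rewrite -leqn0 leqNgt; apply/negP=> r0.
  suff : (n.+1 <= k %% n.+1)%N by rewrite leqNgt ltn_mod.
  by apply: nmin; apply/asboolP; split=> //; exists (y - d *+ (k %/ n.+1)).
have := Gr; rewrite r0 mulr0n => /G0/subr0_eq ->.
by rewrite -eP -mulrnA; congr (_ *+ _); rewrite mulnC {2}(divn_eq k n.+1) r0 addn0.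
Qed.

Lemma padd_extend b : exists2 H, partial_additive H &
  G `<=` H /\ exists e, H (b, e).
Proof.
have [e eP] := padd_extend_elt b; have [G00 GB G0] := paG.
exists [set u | exists x y k, G (x, y) /\ u = (x + b *~ k, y + e *~ k)]; last first.
  split; first by move=> [x y] Gxy; exists x, y, 0; rewrite !mulr0z !addr0.
  by exists e, 0, 0, 1; rewrite !mulr1z !add0r.
split.
- by exists 0, 0, 0; rewrite !mulr0z !addr0.
- move=> _ _ _ _ [x [y [k [Gxy [-> ->]]]]] [x' [y' [k' [Gxy' [-> ->]]]]].
  exists (x - x'), (y - y'), (k - k'); split; first exact: GB.
  by rewrite !mulrzBr !opprD ![_ + _ *~ _ + _]addrACA.
move=> _ [x [y [k [Gxy [/esym/eqP xk ->]]]]].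
move: xk; rewrite addr_eq0 -mulrNz => /eqP xk.
by move: Gxy; rewrite xk => /eP ->; rewrite mulrNz addNr.
Qed.

End PartialAdditive.

(** Divisible groups are injective. Starting from a graph spares forming its domain as a group. *)
Lemma divisible_extend (G0 : set (B * D)) : partial_additive G0 ->
  exists h : {additive B -> D}, forall x y, G0 (x, y) -> h x = y.
Proof.
move=> pa0; have [|G [paG G0G] Gmax] := @Zorn_above _ partial_additive _ pa0.
  move=> F FP [X FX] totF; have [X0 _ _] := FP X FX; split; first by exists X.
    move=> x y x' y' [Y FY Yxy] [Z FZ Zxy].
    have [YZ|ZY] := totF Y Z FY FZ.
      by exists Z => //; have [_ ZB _] := FP Z FZ; apply: ZB => //; apply: YZ.
    by exists Y => //; have [_ YB _] := FP Y FY; apply: YB => //; apply: ZY.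
  by move=> y [Y FY]; have [_ _] := FP Y FY; apply.
have tot b : exists e, G (b, e).
  have [H paH [GH [e He]]] := padd_extend paG b.
  by exists e; apply: (Gmax H).
pose h b := projT1 (cid (tot b)).
have hP b : G (b, h b) by rewrite /h; case: cid.
have ah : zmod_morphism h.
  move=> x y; apply: (padd_fun paG _ (hP _)).
  by case: paG => _ GB _; apply: GB.
exists (mkadd ah) => x y /G0G Gxy.
exact: (padd_fun paG Gxy (hP x)).
Qed.

End Divisible.

Definition int_subgrp : subgrp rat.
Proof.
exists (fun x : rat => exists z : int, x = z%:~R) => [|_ _ [a ->] [b ->]].
  by exists 0.
by exists (a - b); rewrite rmorphB.
Defined.

Definition QmodZ : zmodType := quo_type int_subgrp.

Lemma QmodZ_divisible : divisible QmodZ.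
Proof.
move=> n d; have [q <-] := quo_pi_surj d.
exists (quo_pi int_subgrp (q / n.+1%:R)); rewrite -raddfMn /=; congr quo_pi.
by rewrite -[LHS]mulr_natr divfK // pnatr_eq0.
Qed.

(** On the cyclic group of [m], send [m] to the class of 1/n if its order is n, and of 1/2 if its
    order is infinite; then extend by divisibility. *)
Lemma QmodZ_cogenerator (A : zmodType) (m : A) : m <> 0 ->
  exists h : {additive A -> QmodZ}, h m <> 0.
Proof.
move=> m0.
suff [c c0 cP] : exists2 c : QmodZ, c <> 0 & forall k : int, m *~ k = 0 -> c *~ k = 0.
  have [|h hP] := @divisible_extend A QmodZ QmodZ_divisible
      [set u | exists k : int, u = (m *~ k, c *~ k)].
    split; first by exists 0; rewrite !mulr0z.
      move=> _ _ _ _ [k [-> ->]] [k' [-> ->]].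
      by exists (k - k'); rewrite !mulrzBr.
    by move=> _ [k [/esym/cP k0 ->]].
  by exists h; rewrite (hP m c) //; exists 1; rewrite !mulr1z.
suff [q q0 qP] : exists2 q : rat, ~ int_subgrp q &
    forall n : nat, m *+ n = 0 -> int_subgrp (q *+ n).
  exists (quo_pi int_subgrp q) => [/quo_pi_eq0//|[n|n]].
    by move=> /qP/quo_pi_eq0; rewrite raddfMn.
  move=> /eqP; rewrite NegzE !mulrNz oppr_eq0 -!pmulrn => /eqP/qP/quo_pi_eq0.
  by rewrite raddfMn /= => ->; rewrite oppr0.
have notint n : ~ int_subgrp (n.+2%:R^-1).
  move=> [z zP].
  have : (z * n.+2%:Z)%:~R = 1 :> rat.
    by rewrite rmorphM /= -zP mulVf // pnatr_eq0.
  move=> /eqP; rewrite -[1]/(1%:~R) eqr_int => /eqP e.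
  have : (n.+2%:Z %| 1)%Z by apply/dvdzP; exists z.
  by rewrite dvdz1.
have [ex|nex] := pselect (exists n, (0 < n)%N && (m *+ n == 0)); last first.
  exists 2%:R^-1 => [|[|n] mn]; first exact: notint.
    by rewrite mulr0n; exists 0.
  by case: nex; exists n.+1; rewrite mn eqxx.
case: (ex_minnP ex) => -[|[|n]] // /andP[_ /eqP mn] nmin.
  by case: m0; rewrite -mn.
exists n.+2%:R^-1 => [|k mk]; first exact: notint.
have r0 : (k %% n.+2)%N = 0%N.
  apply/eqP; rewrite -leqn0 leqNgt; apply/negP=> r0.
  suff : (n.+2 <= k %% n.+2)%N by rewrite leqNgt ltn_mod.
  apply: nmin; rewrite r0 /=; apply/eqP; move: mk.
  by rewrite {1}(divn_eq k n.+2) mulrnDr mulnC mulrnA mn mul0rn add0r.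
exists (k %/ n.+2)%N%:Z.
rewrite {1}(divn_eq k n.+2) r0 addn0 mulnC mulrnA -[_ *+ n.+2]mulr_natr.
by rewrite mulVf ?pnatr_eq0 // -pmulrn.
Qed.

(** * Coinduced modules and embeddings into injectives *)

Section Coinduced.
Variables (R : pzRingType) (D : zmodType).

Definition coind := R -> D.
HB.instance Definition _ := GRing.Zmodule.on coind.

Definition coind_scale (r : R) (f : coind) : coind := fun x => f (x * r).

Lemma coind_scaleA a b f : coind_scale a (coind_scale b f) = coind_scale (a * b) f.
Proof. by apply/funext => x; rewrite /coind_scale mulrA. Qed.
Lemma coind_scale1 : left_id 1 coind_scale.
Proof. by move=> f; apply/funext => x; rewrite /coind_scale mulr1. Qed.
(* a |-> a f is not additive on coind, only on its submodule of additive
   functions. *)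
Definition addhom_pred : pred coind :=
  fun f => `[<forall x y, f (x - y) = f x - f y>].
Definition addhom := {f : coind | addhom_pred f}.
HB.instance Definition _ := [isSub of addhom for @sval _ _].
HB.instance Definition _ := [Choice of addhom by <:].

Lemma addhom_zmod_closed : zmod_closed addhom_pred.
Proof.
split=> [|f g /asboolP fP /asboolP gP]; apply/asboolP => x y.
  by rewrite subr0.
change (f (x - y) - g (x - y) = (f x - g x) - (f y - g y)).
by rewrite fP gP !opprD !opprK addrACA.
Qed.

HB.instance Definition _ := GRing.SubChoice_isSubZmodule.Build coind
  addhom_pred addhom addhom_zmod_closed.

Lemma addhomP (f : addhom) x y : val f (x - y) = val f x - val f y.
Proof. exact: (asboolP _ (valP f)). Qed.

Lemma addhomD (f : addhom) x y : val f (x + y) = val f x + val f y.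
Proof.
have f0 : val f 0 = 0 by have := addhomP f 0 0; rewrite !subrr.
have fN z : val f (- z) = - val f z.
  by have := addhomP f 0 z; rewrite f0 !sub0r.
by rewrite -{1}[y]opprK addhomP fN opprK.
Qed.

Definition mk_addhom (f : {additive R -> D}) : addhom :=
  exist addhom_pred (f : coind) (introT (asboolP _) (raddfB f)).

Lemma addhom_scale_subproof r (f : addhom) :
  addhom_pred (coind_scale r (val f)).
Proof. by apply/asboolP => x y; rewrite /coind_scale mulrBl; apply: addhomP. Qed.

Definition addhom_scale r (f : addhom) : addhom :=
  exist addhom_pred _ (addhom_scale_subproof r f).

Lemma addhom_scaleA a b f :
  addhom_scale a (addhom_scale b f) = addhom_scale (a * b) f.
Proof. exact/val_inj/coind_scaleA. Qed.
Lemma addhom_scale1 : left_id 1 addhom_scale.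
Proof. by move=> f; apply/val_inj/coind_scale1. Qed.
Lemma addhom_scaleDr : right_distributive addhom_scale +%R.
Proof. by move=> a f g; apply/val_inj. Qed.
Lemma addhom_scaleDl f : {morph addhom_scale^~ f : a b / a + b}.
Proof.
move=> a b; apply/val_inj/funext => x.
by rewrite /= /coind_scale mulrDr addhomD.
Qed.

HB.instance Definition _ := GRing.Zmodule_isLmodule.Build R addhom
  addhom_scaleA addhom_scale1 addhom_scaleDr addhom_scaleDl.

(* Hom_R(A, Hom_Z(R, D)) = Hom_Z(A, D) *)
Lemma addhom_inj : divisible D -> Inj (addhom : lmodType R).
Proof.
move=> divD A B g f injg.
have [|h hP] := @divisible_extend B D divD
    [set u | exists a, u = (g a, val (f a) 1)].
  split; first by exists 0; rewrite !linear0.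
    move=> _ _ _ _ [a [-> ->]] [a' [-> ->]].
    by exists (a - a'); rewrite !linearB.
  move=> y [a [/esym ga ->]]; have -> : a = 0 by apply: injg; rewrite ga linear0.
  by rewrite linear0.
have addH b : zmod_morphism (fun x : R => h (x *: b)).
  by move=> x y; rewrite scalerBl raddfB.
pose H b := mk_addhom (mkadd (addH b)).
have linH : linear H.
  move=> r b b'; apply/val_inj/funext => x /=.
  change (h (x *: (r *: b + b')) = h ((x * r) *: b) + h (x *: b')).
  by rewrite scalerDr raddfD scalerA.
exists (mklin linH) => a; apply/val_inj/funext => x /=.
rewrite -linearZ (hP _ (val (f (x *: a)) 1)); last by exists (x *: a).
by rewrite linearZ /= /coind_scale mul1r.
Qed.

End Coinduced.

Section Hull.
Variables (R : pzRingType) (M : lmodType R).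

(** One coordinate per element of [M]: each nonzero element gets a character that does not vanish on
    it. *)
Definition char_power : zmodType := M -> QmodZ.

Lemma char_power_divisible : divisible char_power.
Proof.
move=> n d; have [e eP] := choice (fun m => QmodZ_divisible n (d m)).
exists e; apply/funext => m; rewrite -[RHS]eP.
elim: n.+1 => [|k IHk]; first by rewrite !mulr0n.
by rewrite !mulrS -IHk.
Qed.

Lemma char_embedding : exists f : {additive M -> char_power}, forall m, f m = 0 -> m = 0.
Proof.
have /choice[c cP] : forall m : M, exists h : {additive M -> QmodZ}, m <> 0 -> h m <> 0.
  have z0 : zmod_morphism ((fun=> 0) : M -> QmodZ) by move=> x y; rewrite subr0.
  move=> m; have [->|m0] := pselect (m = 0); first by exists (mkadd z0).
  by have [h hP] := QmodZ_cogenerator m0; exists h.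
have ae : zmod_morphism (fun m : M => (fun m' => c m' m) : char_power).
  by move=> x y; apply/funext => m; apply: raddfB.
exists (mkadd ae) => m /= e; apply: contrapT => /cP; apply.
exact: (congr1 (fun f : M -> QmodZ => f m) e).
Qed.

(** Hom_Z(R, D) for D a power of Q/Z. It contains [M] but is not claimed to be a minimal injective
    extension. *)
Definition hull : lmodType R := addhom R char_power.

Lemma hull_inj : Inj hull.
Proof. exact/addhom_inj/char_power_divisible. Qed.

Lemma hull_embedding : exists f : {linear M -> hull}, injective f.
Proof.
have [e eP] := char_embedding.
have addH m : zmod_morphism (fun x : R => e (x *: m)).
  by move=> x y; rewrite scalerBl raddfB.
pose H m : hull := mk_addhom (mkadd (addH m)).
have linH : linear H.
  move=> r b b'; apply/val_inj/funext => x /=.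
  change (e (x *: (r *: b + b')) = e ((x * r) *: b) + e (x *: b')).
  by rewrite scalerDr raddfD scalerA.
exists (mklin linH); apply: lin_inj => m /(congr1 (fun f : hull => val f 1)) /=.
by rewrite scale1r => /eP.
Qed.

Definition hull_in : {linear M -> hull} := projT1 (cid hull_embedding).

Definition cosyz : lmodType R := quo (range_submod hull_in).

Lemma cosyz_ses : ses hull_in (quo_proj (range_submod hull_in)).
Proof.
split; [exact: (projT2 (cid hull_embedding))|exact: quo_proj_eq0|].
exact: quo_proj_surj.
Qed.

End Hull.

Local Close Scope classical_set_scope.

(** * The functor Ext^1 *)

Section Ext.
Variable R : pzRingType.
Implicit Types A B C D K M N P I : lmodType R.

(* Ext^1(M, N) = 0 *)
Definition Ext1 M N := forall A B (i : {linear A -> B}) (p : {linear B -> M}),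
  ses i p -> forall f : {linear A -> N},
  exists h : {linear B -> N}, forall x, h (i x) = f x.

(** A lift on the free cover of [M] restricts on the syzygy to a map into [N]; [Ext1] extends this
    defect to the cover, where it is subtracted. *)
Lemma ext1_lift M N B C (i : {linear N -> B}) (p : {linear B -> C})
    (g : {linear M -> C}) :
  Ext1 M N -> ses i p -> exists h : {linear M -> B}, forall x, p (h x) = g x.
Proof.
move=> eMN [inji ex sp]; have sesM := syz_ses M; have [_ exM sM] := sesM.
have [h hP] := free_proj (g \o cover M) sp.
have [x|k kP] := factor_ker (f := h \o submod_incl (kernel (cover M))) inji ex.
  by rewrite /= hP /= (ses_comp0 _ exM) linear0.
have [e eP] := eMN _ _ _ _ sesM k.
have [x|q qP] := factor_coker (f := h \- (i \o e)) sM exM.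
  by rewrite /= eP kP subrr.
exists q => m; have [x <-] := sM m.
by rewrite qP /= linearB /= hP (ses_comp0 _ ex) subr0.
Qed.

Lemma ext1_of_lift M N I C (i : {linear N -> I}) (p : {linear I -> C}) :
  Inj I -> ses i p ->
  (forall g : {linear M -> C}, exists h : {linear M -> I}, forall x, p (h x) = g x) ->
  Ext1 M N.
Proof.
move=> injI [inji ex sp] lift A B j q [injj exj sq] f.
have [h hP] := injI _ _ j (i \o f) injj.
have [x|g gP] := factor_coker (f := p \o h) sq exj.
  by rewrite /= hP /= (ses_comp0 _ ex).
have [l lP] := lift g.
have [x|k kP] := factor_ker (f := h \- (l \o q)) inji ex.
  by rewrite /= linearB /= lP gP subrr.
exists k => x; apply: inji; rewrite kP /= hP (ses_comp0 _ exj) linear0 subr0.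
by [].
Qed.

(** Independence of the presentation of [M]: extending maps into [N] is traded for lifting along the
    cosyzygy sequence of [N], where [ext1_of_lift] applies. *)
Lemma ext1_of_extend K P M N (i : {linear K -> P}) (p : {linear P -> M}) :
  Proj P -> ses i p ->
  (forall f : {linear K -> N}, exists h : {linear P -> N}, forall x, h (i x) = f x) ->
  Ext1 M N.
Proof.
move=> projP [inji ex sp] ext.
have sesN := cosyz_ses N; have [injN exN sN] := sesN.
apply: (ext1_of_lift (@hull_inj R N) sesN) => g.
have [h hP] := projP _ _ _ (g \o p) sN.
have [x|k kP] := factor_ker (f := h \o i) injN exN.
  by rewrite /= hP /= (ses_comp0 _ ex) linear0.
have [e eP] := ext k.
have [x|q qP] := factor_coker (f := h \- (hull_in N \o e)) sp ex.
  by rewrite /= eP kP subrr.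
exists q => m; have [x <-] := sp m.
by rewrite qP /= linearB /= hP (ses_comp0 _ exN) subr0.
Qed.

Lemma ext1_proj P N : Proj P -> Ext1 P N.
Proof.
move=> projP; have sesN := cosyz_ses N; have [_ _ sN] := sesN.
apply: (ext1_of_lift (@hull_inj R N) sesN) => g; exact: projP.
Qed.

Lemma ext1_inj M I : Inj I -> Ext1 M I.
Proof. by move=> injI A B i p [inji _ _] f; apply: injI. Qed.

Lemma proj_of_ext1 M : (forall N, Ext1 M N) -> Proj M.
Proof.
move=> eM B C g f sg; apply: (ext1_lift f (eM (submod_lmod (kernel g)))).
by split; [exact: submod_incl_inj|exact: kernel_exact|].
Qed.

Lemma coker_ses A B (i : {linear A -> B}) : injective i ->
  ses i (quo_proj (range_submod i)).
Proof.
by move=> inji; split=> //; [exact: quo_proj_eq0|exact: quo_proj_surj].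
Qed.

Lemma ker_ses A B (p : {linear A -> B}) : surjective_map p ->
  ses (submod_incl (kernel p)) p.
Proof.
by split; [exact: submod_incl_inj|exact: kernel_exact|].
Qed.

Lemma inj_of_ext1 N : (forall M, Ext1 M N) -> Inj N.
Proof. by move=> eN A B g f /coker_ses s; apply: (eN _ _ _ _ _ s). Qed.

Section LongExact.
Variables (K G M N I C : lmodType R).
Variables (i : {linear K -> G}) (p : {linear G -> M}) (sG : ses i p).
Variables (j : {linear N -> I}) (q : {linear I -> C}) (sI : ses j q).

(* Ext^1(K, N) -> Ext^2(M, N) -> Ext^2(G, N), with C a cosyzygy of N. *)
Lemma ext2_quo : Inj I -> Ext1 K N -> Ext1 G C -> Ext1 M C.
Proof.
move=> injI eKN eGC.
have sesC := cosyz_ses C; have [injC exC sC] := sesC.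
have [inji exG sp] := sG; have [injj exI sq] := sI.
apply: (ext1_of_lift (@hull_inj R C) sesC) => g.
have [h hP] := ext1_lift (g \o p) eGC sesC.
have [x|k kP] := factor_ker (f := h \o i) injC exC.
  by rewrite /= hP /= (ses_comp0 _ exG) linear0.
have [l lP] := ext1_lift k eKN sI.
have [e eP] := injI _ _ i l inji.
have [x|r rP] := factor_coker (f := h \- (hull_in C \o (q \o e))) sp exG.
  by rewrite /= eP lP kP subrr.
exists r => m; have [x <-] := sp m.
by rewrite rP /= linearB /= hP (ses_comp0 _ exC) subr0.
Qed.

(* Ext^1(G, N) -> Ext^1(K, N) -> Ext^2(M, N) *)
Lemma ext1_sub : Inj I -> Ext1 G N -> Ext1 M C -> Ext1 K N.
Proof.
move=> injI eGN eMC; apply: (ext1_of_lift injI sI) => g.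
have [h hP] := eMC _ _ _ _ sG g.
have [l lP] := ext1_lift h eGN sI.
by exists (l \o i) => x /=; rewrite lP.
Qed.

(* Both sides compute Ext^2(M, N). *)
Lemma ext1_shift : Proj G -> Inj I -> Ext1 K N <-> Ext1 M C.
Proof.
move=> projG injI; split=> [eKN|eMC].
  by apply: ext2_quo => //; apply: ext1_proj.
by apply: ext1_sub => //; apply: ext1_proj.
Qed.

End LongExact.

Lemma ext1_shift_canon M N : Ext1 (syz M) N <-> Ext1 M (cosyz N).
Proof.
exact: (ext1_shift (syz_ses M) (cosyz_ses N) (@free_proj R _) (@hull_inj R N)).
Qed.

(** The piece Ext^1(M, B) -> Ext^1(M, C) -> Ext^2(M, A) of the long exact sequence. *)
Lemma ext1_quo M A B C (i : {linear A -> B}) (p : {linear B -> C}) :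
  ses i p -> Ext1 M B -> Ext1 (syz M) A -> Ext1 M C.
Proof.
move=> s eMB eKA; have sesM := syz_ses M.
apply: (ext1_of_extend (@free_proj R _) sesM) => f.
have [h hP] := ext1_lift f eKA s.
have [l lP] := eMB _ _ _ _ sesM h.
by exists (p \o l) => x /=; rewrite lP hP.
Qed.

(** The piece Ext^1(M, C) -> Ext^2(M, A) -> Ext^2(M, B) of the long exact sequence. *)
Lemma ext1_sub_r M A B C (i : {linear A -> B}) (p : {linear B -> C}) :
  ses i p -> Ext1 M C -> Ext1 (syz M) B -> Ext1 (syz M) A.
Proof.
move=> s eMC eKB; have [inji ex sp] := s.
have sesM := syz_ses M; have sesK := syz_ses (syz M); have [_ exK sK] := sesK.
apply: (ext1_of_extend (@free_proj R _) sesK) => f.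
have [h hP] := eKB _ _ _ _ sesK (i \o f).
have [x|g gP] := factor_coker (f := p \o h) sK exK.
  by rewrite /= hP /= (ses_comp0 _ ex).
have [l lP] := eMC _ _ _ _ sesM g.
have [e eP] := free_proj l sp.
have [x|k kP] := factor_ker
  (f := h \- (e \o (submod_incl (kernel (cover M)) \o cover (syz M)))) inji ex.
  by rewrite /= linearB /= eP lP gP subrr.
exists k => x; apply: inji; rewrite kP /= hP /= (ses_comp0 _ exK).
by rewrite !linear0 addr0.
Qed.

End Ext.

(** * Projective and injective dimension *)

Section Dim.
Variable R : pzRingType.
Implicit Types A B C D K G L M N P I E : lmodType R.

Definition iso A B (f : {linear A -> B}) := injective f /\ surjective_map f.

Lemma iso_inv A B (f : {linear A -> B}) : iso f ->
  exists g : {linear B -> A}, cancel f g /\ cancel g f.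
Proof.
move=> [injf sf].
have [//|a x y x' y' <- <-|y|h hP] := @lin_of_rel R B A (fun y x => f x = y).
- by rewrite linearP.
- by rewrite -(linear0 f) => /injf.
exists h; split=> x; first exact/esym/hP.
exact/hP.
Qed.

Lemma ext1_iso_l G M N (f : {linear G -> M}) : iso f -> Ext1 G N -> Ext1 M N.
Proof.
move=> /iso_inv[g [fK gK]] eGN A B i p [inji ex sp].
apply: (eGN A B i (g \o p)); split=> // [y|x]; last first.
  by have [b bP] := sp (f x); exists b; rewrite /= bP fK.
rewrite -ex /=; split=> [e|->]; last by rewrite linear0.
by rewrite -[p y]gK e linear0.
Qed.

Lemma ext1_iso_r M N E (f : {linear N -> E}) : iso f -> Ext1 M E -> Ext1 M N.
Proof.
move=> /iso_inv[g [fK gK]] eME A B i p s h.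
have [k kP] := eME A B i p s (f \o h).
by exists (g \o k) => x; rewrite /= kP /= fK.
Qed.

(* Ext^(k+1)(M, N) = 0 *)
Definition ExtN k M N := Ext1 (iter k (@syz R) M) N.

(** Syzygies move to the other argument one at a time. Statements about [Ext1] thus pass to all
    degrees by replacing [N] with an iterated cosyzygy. *)
Lemma extN_cosyz k M N : ExtN k M N <-> Ext1 M (iter k (@cosyz R) N).
Proof.
rewrite /ExtN; elim: k N => // k IHk N.
by rewrite iterS ext1_shift_canon IHk -iterSr.
Qed.

Lemma extN_shift_l k K P M N (i : {linear K -> P}) (p : {linear P -> M}) :
  Proj P -> ses i p -> ExtN k K N <-> ExtN k.+1 M N.
Proof.
move=> projP s; rewrite !extN_cosyz iterS.
exact: (ext1_shift s (cosyz_ses _) projP (@hull_inj R _)).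
Qed.

Lemma extN_shift_r k M N I C (i : {linear N -> I}) (p : {linear I -> C}) :
  Inj I -> ses i p -> ExtN k M C <-> ExtN k.+1 M N.
Proof.
move=> injI s; rewrite /ExtN iterS.
by rewrite (ext1_shift (syz_ses _) s (@free_proj R _) injI).
Qed.

Lemma extN_quo k K G M N (i : {linear K -> G}) (p : {linear G -> M}) :
  ses i p -> ExtN k K N -> ExtN k.+1 G N -> ExtN k.+1 M N.
Proof.
move=> s; rewrite !extN_cosyz !iterS.
exact: (ext2_quo s (cosyz_ses _) (@hull_inj R _)).
Qed.

Lemma extN_sub k K G M N (i : {linear K -> G}) (p : {linear G -> M}) :
  ses i p -> ExtN k G N -> ExtN k.+1 M N -> ExtN k K N.
Proof.
move=> s; rewrite !extN_cosyz !iterS.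
exact: (ext1_sub s (cosyz_ses _) (@hull_inj R _)).
Qed.

Lemma extN_quo_r k M A B C (i : {linear A -> B}) (p : {linear B -> C}) :
  ses i p -> ExtN k M B -> ExtN k.+1 M A -> ExtN k M C.
Proof. by move=> s; rewrite /ExtN iterS; apply: ext1_quo s. Qed.

Lemma extN_sub_r k M A B C (i : {linear A -> B}) (p : {linear B -> C}) :
  ses i p -> ExtN k M C -> ExtN k.+1 M B -> ExtN k.+1 M A.
Proof. by move=> s; rewrite /ExtN iterS; apply: ext1_sub_r s. Qed.

(** As [ExtN k] concerns Ext^(k+1), these say pd(M) <= k and, next, id(N) <= k. *)
Definition pdle k M := forall N, ExtN k M N.
Definition idle k N := forall M, ExtN k M N.

Lemma pdle_leq j k M : (j <= k)%N -> pdle j M -> pdle k M.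
Proof.
move=> /subnK <-; elim: (k - j)%N => // d IHd pd N.
exact/(extN_shift_r _ _ (@hull_inj R N) (cosyz_ses N))/IHd.
Qed.

Lemma idle_leq j k N : (j <= k)%N -> idle j N -> idle k N.
Proof.
move=> /subnK <-; elim: (k - j)%N => // d IHd id M.
exact/(extN_shift_l _ _ (@free_proj R M) (syz_ses M))/IHd.
Qed.

Lemma pdle_proj k P : Proj P -> pdle k P.
Proof.
by move=> projP; apply: (pdle_leq (leq0n k)) => N; apply: ext1_proj.
Qed.

Lemma idle_inj k I : Inj I -> idle k I.
Proof.
by move=> injI; apply: (idle_leq (leq0n k)) => N; apply: ext1_inj.
Qed.

(** The form of [has_resolution_of_length] suited to induction. Length 0 is stated up to isomorphism
    because [C] is not assumed closed under it. *)
Fixpoint reslen (C : module_class R) k M : Prop :=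
  if k is k'.+1 then exists K G (i : {linear K -> G}) (p : {linear G -> M}),
    [/\ C G, ses i p & reslen C k' K]
  else exists G (f : {linear G -> M}), C G /\ iso f.

Fixpoint coreslen (C : module_class R) k M : Prop :=
  if k is k'.+1 then exists G L (i : {linear M -> G}) (p : {linear G -> L}),
    [/\ C G, ses i p & coreslen C k' L]
  else exists G (f : {linear M -> G}), C G /\ iso f.

Lemma reslen_pdle k M : reslen (@Proj R) k M -> pdle k M.
Proof.
elim: k M => [|k IHk] M.
  by move=> [G [f [projG isof]]] N; apply: (ext1_iso_l isof); apply: ext1_proj.
move=> [K [G [i [p [projG s /IHk pdK]]]]] N.
exact/(extN_shift_l _ _ projG s)/pdK.
Qed.

Lemma coreslen_idle k M : coreslen (@Inj R) k M -> idle k M.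
Proof.
elim: k M => [|k IHk] M.
  by move=> [G [f [injG isof]]] N; apply: (ext1_iso_r isof); apply: ext1_inj.
move=> [G [L [i [p [injG s /IHk idL]]]]] N.
exact/(extN_shift_r _ _ injG s)/idL.
Qed.

Lemma iso_id M : iso (idfun : {linear M -> M}).
Proof. by split=> // x; exists x. Qed.

Lemma reslen_syz (C : module_class R) k M :
  (forall P, Proj P -> C P) -> C (iter k (@syz R) M) -> reslen C k M.
Proof.
move=> projC; elim: k M => [|k IHk] M CM.
  by exists M, idfun; split; [|apply: iso_id].
exists (syz M), (free R M), (submod_incl _), (cover M).
by split; [exact/projC/free_proj|exact: syz_ses|apply: IHk; rewrite -iterSr].
Qed.

Lemma coreslen_cosyz (C : module_class R) k M :
  (forall I, Inj I -> C I) -> C (iter k (@cosyz R) M) -> coreslen C k M.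
Proof.
move=> injC; elim: k M => [|k IHk] M CM.
  by exists M, idfun; split; [|apply: iso_id].
exists (hull M), (cosyz M), (hull_in M), (quo_proj _).
by split; [exact/injC/hull_inj|exact: cosyz_ses|apply: IHk; rewrite -iterSr].
Qed.

Definition zero_lin A B : {linear A -> B}.
Proof.
by apply: (@mklin R A B (fun=> 0)) => a x y; rewrite scaler0 addr0.
Defined.

Lemma zero_rV : is_zero_module ('rV[R]_0 : lmodType R).
Proof. by move=> x; apply: thinmx0. Qed.

Lemma zero_exact A (T : nmodType) (f : {linear A -> 'rV[R]_0}) (g : T -> A) :
  (forall y, exists x, g x = y) -> exact_at g f.
Proof. by move=> sg y; split=> [_|_]; [exact: sg|exact: zero_rV]. Qed.

Section Cons.
Variables (K G M : lmodType R) (i : {linear K -> G}) (p : {linear G -> M}).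
Hypothesis s : ses i p.

Definition res_cons_obj (r : resolution K) n : lmodType R :=
  if n is n'.+1 then r n' else G.

Definition res_cons_diff (r : resolution K) n :
    {linear res_cons_obj r n.+1 -> res_cons_obj r n} :=
  match n with
  | 0%N => (i \o res_aug r : {linear r 0%N -> G})
  | n'.+1 => res_diff r n'
  end.

(** Only the objects are recorded: [has_resolution_of_length] constrains nothing else. *)
Lemma res_cons (r : resolution K) :
  exists r' : resolution M, res_obj r' = res_cons_obj r.
Proof.
have [inji ex sp] := s.
unshelve eexists; first apply: (@Resolution R M (res_cons_obj r) (res_cons_diff r) p sp).
- move=> y; split=> [/ex[x <-]|[x <-]]; last exact: ses_comp0 ex.
  by have [z <-] := res_aug_surj r x; exists z.
- case=> [|n] y; last exact: res_exact.
  rewrite -res_exact0 /=; split=> [e|->]; last by rewrite linear0.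
  by apply: inji; rewrite e linear0.
- by [].
Qed.

End Cons.

Lemma res_of_reslen (C : module_class R) M n :
  reslen C n M -> has_resolution_of_length C M n.
Proof.
elim: n M => [|n IHn] M /=; last first.
  move=> [K [G [i [p [CG s /IHn[r [rC r0]]]]]]].
  have [r' r'E] := res_cons s r.
  by exists r'; rewrite r'E; split=> -[|j] //; [apply: rC|apply: r0].
move=> [G [f [CG [injf sf]]]].
pose X i : lmodType R := if i is _.+1 then 'rV[R]_0 else G.
have e0 : exact_at (zero_lin (X 1%N) (X 0%N)) f.
  move=> y; split=> [fy|[x <-]]; last by rewrite linear0.
  by exists 0; apply: injf; rewrite fy linear0.
have e i : exact_at (zero_lin (X i.+2) (X i.+1)) (zero_lin (X i.+1) (X i)).
  by move=> y; split=> // _; exists 0; rewrite linear0; apply/esym/zero_rV.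
exists (@Resolution R M X (fun i => zero_lin (X i.+1) (X i)) f sf e0 e).
by split=> -[|i] // _; apply: zero_rV.
Qed.

Section Tail.
Variables (M : lmodType R) (r : resolution M).

Definition res_cycle : lmodType R := submod_lmod (kernel (res_aug r)).

Lemma res_cycle_aug : exists h : {linear r 1%N -> res_cycle},
  forall x, submod_incl (kernel (res_aug r)) (h x) = res_diff r 0%N x.
Proof.
apply: factor_ker => [||x]; [exact: submod_incl_inj|exact: kernel_exact|].
by apply/res_exact0; exists x.
Qed.

Lemma res_tail : exists r' : resolution res_cycle, res_obj r' = fun n => r n.+1.
Proof.
have [h hP] := res_cycle_aug.
unshelve eexists; first apply: (@Resolution R res_cycle (fun n => r n.+1) (fun n => res_diff r n.+1) h).
- move=> y; have /res_exact0[x xP] := submod_inclP y.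
  by exists x; apply: submod_incl_inj; rewrite hP.
- move=> y; rewrite -res_exact -hP; split=> [->|e]; first exact: linear0.
  by apply: submod_incl_inj; rewrite e linear0.
- by move=> i; apply: res_exact.
- by [].
Qed.

End Tail.

Lemma reslen_of_res (C : module_class R) M n :
  has_resolution_of_length C M n -> reslen C n M.
Proof.
elim: n M => [|n IHn] M [r [rC r0]] /=.
  exists (r 0%N), (res_aug r); split; first exact: rC.
  split; last exact: res_aug_surj.
  apply: lin_inj => x /res_exact0[y <-].
  by rewrite (r0 1%N _ y) // linear0.
exists (res_cycle r), (r 0%N), (submod_incl _), (res_aug r); split.
- exact: rC.
- by apply: ker_ses; apply: res_aug_surj.
have [r' r'E] := res_tail r.
by apply: IHn; exists r'; rewrite r'E; split=> i ilen; [apply: rC|apply: r0].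
Qed.

Section CoCons.
Variables (M G L : lmodType R) (i : {linear M -> G}) (p : {linear G -> L}).
Hypothesis s : ses i p.

Definition cores_cons_obj (r : coresolution L) n : lmodType R :=
  if n is n'.+1 then r n' else G.

Definition cores_cons_diff (r : coresolution L) n :
    {linear cores_cons_obj r n -> cores_cons_obj r n.+1} :=
  match n with
  | 0%N => (cores_aug r \o p : {linear G -> r 0%N})
  | n'.+1 => cores_diff r n'
  end.

Lemma cores_cons (r : coresolution L) :
  exists r' : coresolution M, cores_obj r' = cores_cons_obj r.
Proof.
have [inji ex sp] := s.
unshelve eexists; first apply: (@Coresolution R M (cores_cons_obj r) (cores_cons_diff r) i inji).
- move=> y; rewrite -ex /=; split=> [e|->]; last by rewrite linear0.
  by apply: (@cores_aug_inj _ _ r); rewrite e linear0.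
- case=> [|n] y; last exact: cores_exact.
  rewrite /= cores_exact0; split=> [[x <-]|[x <-]]; last by exists (p x).
  by have [z <-] := sp x; exists z.
- by [].
Qed.

End CoCons.

Lemma cores_of_coreslen (C : module_class R) M n :
  coreslen C n M -> has_coresolution_of_length C M n.
Proof.
elim: n M => [|n IHn] M /=; last first.
  move=> [G [L [i [p [CG s /IHn[r [rC r0]]]]]]].
  have [r' r'E] := cores_cons s r.
  by exists r'; rewrite r'E; split=> -[|j] //; [apply: rC|apply: r0].
move=> [G [f [CG [injf sf]]]].
pose X i : lmodType R := if i is _.+1 then 'rV[R]_0 else G.
have e0 : exact_at f (zero_lin (X 0%N) (X 1%N)).
  by move=> y; split=> // _; apply: sf.
have e i : exact_at (zero_lin (X i) (X i.+1)) (zero_lin (X i.+1) (X i.+2)).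
  by move=> y; split=> // _; exists 0; rewrite linear0; apply/esym/zero_rV.
exists (@Coresolution R M X (fun i => zero_lin (X i) (X i.+1)) f injf e0 e).
by split=> -[|i] // _; apply: zero_rV.
Qed.

Section CoTail.
Variables (M : lmodType R) (r : coresolution M).

Definition cores_cocycle : lmodType R := quo (range_submod (cores_aug r)).

Lemma cores_cocycle_aug : exists h : {linear cores_cocycle -> r 1%N},
  forall x, h (quo_proj (range_submod (cores_aug r)) x) = cores_diff r 0%N x.
Proof.
have [_ ex sp] := coker_ses (@cores_aug_inj _ _ r).
by apply: (factor_coker sp ex) => x; apply/cores_exact0; exists x.
Qed.

Lemma cores_tail : exists r' : coresolution cores_cocycle, cores_obj r' = fun n => r n.+1.
Proof.
have [h hP] := cores_cocycle_aug.
unshelve eexists; first apply: (@Coresolution R cores_cocycle (fun n => r n.+1) (fun n => cores_diff r n.+1) h).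
- apply: lin_inj => u; have [x <-] := quo_proj_surj u.
  by rewrite hP => e; apply/quo_proj_eq0/cores_exact0.
- move=> y; rewrite cores_exact; split=> [[x <-]|[u <-]].
    by exists (quo_proj _ x); rewrite hP.
  by have [x <-] := quo_proj_surj u; exists x; rewrite hP.
- by move=> i; apply: cores_exact.
- by [].
Qed.

End CoTail.

Lemma coreslen_of_cores (C : module_class R) M n :
  has_coresolution_of_length C M n -> coreslen C n M.
Proof.
elim: n M => [|n IHn] M [r [rC r0]] /=.
  exists (r 0%N), (cores_aug r); split; first exact: rC.
  split; first exact: cores_aug_inj.
  by move=> y; apply/cores_exact0/(r0 1%N).
exists (r 0%N), (cores_cocycle r), (cores_aug r), (quo_proj _); split.
- exact: rC.
- exact/coker_ses/cores_aug_inj.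
have [r' r'E] := cores_tail r.
by apply: IHn; exists r'; rewrite r'E; split=> i ilen; [apply: rC|apply: r0].
Qed.

End Dim.

(** * Cycles of exact complexes *)

Section Cycles.
Variable R : pzRingType.
Implicit Types A B C D K G L M N P I E : lmodType R.

(** What remains of [GProj] and [GInj] once Hom-exactness is dropped. *)
Definition exact_cycle (X : module_class R) M :=
  exists2 P : exact_complex R, forall i, X (P i) & is_cycle_of P M.

Definition cycle (P : exact_complex R) (i : int) : lmodType R :=
  submod_lmod (kernel (cpx_diff P i)).

Lemma cycleP (P : exact_complex R) i : is_cycle_of P (cycle P i).
Proof.
exists i, (submod_incl _); split; first exact: submod_incl_inj.
exact: kernel_exact.
Qed.

(** Exactness makes the differential into [P (i + 1)] surjective onto the cycle [M]; its kernel is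
    the next cycle. *)
Lemma cycle_ses (P : exact_complex R) i (M : lmodType R)
    (e : {linear M -> P (i + 1)}) :
  injective e -> exact_at e (cpx_diff P i) ->
  exists2 b : {linear P (i + 1 + 1) -> M},
    forall x, e (b x) = cpx_diff P (i + 1) x &
    ses (submod_incl (kernel (cpx_diff P (i + 1)))) b.
Proof.
move=> inje ex; have [x|b bP] := factor_ker (f := cpx_diff P (i + 1)) inje ex.
  by apply/cpx_exact; exists x.
exists b => //; split; first exact: submod_incl_inj.
  move=> y; rewrite -kernel_exact -bP; split=> [->|ey]; first exact: linear0.
  by apply: inje; rewrite ey linear0.
move=> m; have /cpx_exact[x xP] := ses_comp0 m ex.
by exists x; apply: inje; rewrite bP.
Qed.

(** Cycles live at indices written [i + 1]. Substituting for an index avoids transport along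
    equalities of modules. *)
Lemma int_pred (i : int) : exists j, i = j + 1.
Proof. by exists (i - 1); rewrite subrK. Qed.

Lemma exact_cycle_syz X M : exact_cycle X M ->
  exists K P (i : {linear K -> P}) (p : {linear P -> M}),
    [/\ exact_cycle X K, X P & ses i p].
Proof.
move=> [P XP [i [e [inje ex]]]].
have [b _ s] := cycle_ses inje ex.
exists (cycle P (i + 1)), (P (i + 1 + 1)), (submod_incl _), b; split=> //.
by exists P => //; apply: cycleP.
Qed.

Lemma exact_cycle_cosyz X M : exact_cycle X M ->
  exists P L (i : {linear M -> P}) (p : {linear P -> L}),
    [/\ exact_cycle X L, X P & ses i p].
Proof.
move=> [P XP [i]]; have [j ->] := int_pred i => -[e [inje ex]].
have [b bP [_ exb sb]] := cycle_ses (@submod_incl_inj _ _ _) (kernel_exact (cpx_diff P j)).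
exists (P (j + 1 + 1)), (cycle P j), e, b; split=> //.
  by exists P => //; apply: cycleP.
split=> // y; rewrite -ex -bP; split=> [->|ey]; first exact: linear0.
by apply: submod_incl_inj; rewrite ey linear0.
Qed.

(** A coinduction principle: if each module of [C] continues in both directions within [C], the
    chosen short exact sequences splice into a complex indexed by Z. *)
Lemma exact_cycle_coind (X C : module_class R) :
  (forall M, C M -> exists K P (i : {linear K -> P}) (p : {linear P -> M}),
    [/\ C K, X P & ses i p]) ->
  (forall M, C M -> exists P L (i : {linear M -> P}) (p : {linear P -> L}),
    [/\ C L, X P & ses i p]) ->
  forall M, C M -> exact_cycle X M.
Proof.
move=> hs hc M0 CM0.
pose link K M := exists P (i : {linear K -> P}) (p : {linear P -> M}), X P /\ ses i p.
pose T := {M | C M}.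
have /choice[f fP] : forall M : T, exists K : T, link (sval K) (sval M).
  move=> [M CM]; have [K [P [i [p [CK XP s]]]]] := hs M CM.
  by exists (exist _ K CK), P, i, p.
have /choice[g gP] : forall M : T, exists L : T, link (sval M) (sval L).
  move=> [M CM]; have [P [L [i [p [CL XP s]]]]] := hc M CM.
  by exists (exist _ L CL), P, i, p.
(* [N 0] is [M0]; positive indices iterate [f] to the left, negative ones iterate [g] to the
   right. *)
pose N (i : int) : lmodType R := sval (match i with
  | Posz n => iter n f (exist _ M0 CM0) | Negz n => iter n.+1 g (exist _ M0 CM0) end).
have lnk i : link (N (i + 1)) (N i).
  case: i => [n|[|n]]; first by rewrite -PoszD addn1; apply: fP.
    by rewrite addrC subrr; apply: gP.
  have -> : Negz n.+1 + 1 = Negz n.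
    by rewrite !NegzE -addn1 PoszD opprD subrK.
  exact: gP.
pose Pi i := projT1 (cid (lnk i)).
have lnk2 i := projT2 (cid (lnk i)).
pose a i : {linear N (i + 1) -> Pi i} := projT1 (cid (lnk2 i)).
have lnk3 i := projT2 (cid (lnk2 i)).
pose b i : {linear Pi i -> N i} := projT1 (cid (lnk3 i)).
have abP i : X (Pi i) /\ ses (a i) (b i) := projT2 (cid (lnk3 i)).
have exP i : exact_at (a (i + 1) \o b (i + 1 + 1)) (a i \o b (i + 1)).
  move=> y; have [_ [inja _ _]] := abP i; have [_ [_ ex _]] := abP (i + 1).
  have [_ [_ _ sb]] := abP (i + 1 + 1).
  split=> [e|[x <-]]; last by rewrite /= (ses_comp0 _ ex) linear0.
  have /ex[m <-] : b (i + 1) y = 0 by apply: inja; rewrite linear0; exact: e.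
  by have [x <-] := sb m; exists x.
exists (@ExactComplex R Pi (fun i => a i \o b (i + 1)) exP) => [i|].
  by have [] := abP i.
have cyc i : is_cycle_of (@ExactComplex R Pi (fun i => a i \o b (i + 1)) exP) (N (i + 1 + 1)).
  have [_ [inja _ _]] := abP i; have [_ [injb ex _]] := abP (i + 1).
  exists i, (a (i + 1)); split=> // y; rewrite -ex /=.
  split=> [e|->]; last by rewrite linear0.
  by apply: inja; rewrite e linear0.
(* [Negz 1] is -2, and [N (-2 + 1 + 1)] computes to [M0]. *)
exact: (cyc (Negz 1)).
Qed.

(** A map on [P (i + 1)] killed by the differential factors through a cycle inside [P i]. The
    quotient of [P i] by it is the next cycle to the right, whose [Ext1] into [N] obstructs the
    extension to [P i]. *)
Lemma Hom_from_exact_ext (P : exact_complex R) N :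
  (forall M, is_cycle_of P M -> Ext1 M N) -> Hom_from_exact P N.
Proof.
move=> eN i; have [j ->] := int_pred i; have [l ->] := int_pred j => f fd.
have [b bP s] := cycle_ses (@submod_incl_inj _ _ _) (kernel_exact (cpx_diff P (l + 1))).
have [c cP t] := cycle_ses (@submod_incl_inj _ _ _) (kernel_exact (cpx_diff P l)).
have [_ exb sb] := s.
have [x|h hP] := factor_coker (f := f) sb exb.
  have /cpx_exact[y <-] : cpx_diff P (l + 1 + 1) (submod_incl _ x) = 0 := submod_inclP x.
  exact: fd.
have [g gP] := eN _ (cycleP P l) _ _ _ _ t h.
by exists g => x; rewrite -hP -gP bP.
Qed.

Lemma Hom_to_exact_ext (P : exact_complex R) N :
  (forall M, is_cycle_of P M -> Ext1 N M) -> Hom_to_exact N P.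
Proof.
move=> eN i f df.
have [c cP t] := cycle_ses (@submod_incl_inj _ _ _) (kernel_exact (cpx_diff P i)).
have [h hP] := factor_ker (@submod_incl_inj _ _ _) (kernel_exact (cpx_diff P i)) df.
have [g gP] := ext1_lift h (eN _ (cycleP P (i + 1))) t.
by exists g => x; rewrite -cP gP hP.
Qed.

(** Moving k steps to the right exhibits [M] as a k-th syzygy of [L]. *)
Lemma exact_cycle_proj_cosyz k M : exact_cycle (@Proj R) M ->
  exists2 L, exact_cycle (@Proj R) L &
    forall j N, ExtN (k + j) L N -> ExtN j M N.
Proof.
move=> cM; elim: k => [|k [L cL LP]]; first by exists M.
have [P [L' [i [p [cL' projP s]]]]] := exact_cycle_cosyz cL.
exists L' => // j N e; apply: LP.
exact/(extN_shift_l _ _ projP s).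
Qed.

Lemma exact_cycle_inj_syz k M : exact_cycle (@Inj R) M ->
  exists2 K, exact_cycle (@Inj R) K &
    forall j N, ExtN (k + j) N K -> ExtN j N M.
Proof.
move=> cM; elim: k => [|k [K cK KP]]; first by exists M.
have [K' [I [i [p [cK' injI s]]]]] := exact_cycle_syz cK.
exists K' => // j N e; apply: KP.
exact/(extN_shift_r _ _ injI s).
Qed.

(** For [N] projective, shift by [m] steps so that id(N) <= m applies; then induct on [d] along free
    covers of [N]. *)
Lemma extN_exact_cycle_proj m d j M N :
  (forall Q : lmodType R, Proj Q -> idle m Q) -> exact_cycle (@Proj R) M -> pdle d N ->
  ExtN j M N.
Proof.
move=> idP cM.
have eP i Q : Proj Q -> ExtN i M Q.
  move=> projQ; have [L _ LP] := exact_cycle_proj_cosyz m cM.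
  by apply: LP; apply: (idle_leq (leq_addr i m) (idP _ projQ)).
elim: d N j => [|d IHd] N j pdN; first exact/eP/proj_of_ext1.
apply: (extN_quo_r (syz_ses N)); first exact/eP/free_proj.
by apply: IHd => X; apply/(extN_shift_l _ _ (@free_proj R N) (syz_ses N)).
Qed.

(** After [d] shifts to the left the degree exceeds pd(N). *)
Lemma extN_exact_cycle_inj d j M N :
  exact_cycle (@Inj R) M -> pdle d N -> ExtN j N M.
Proof.
move=> cM pdN; have [K _ KP] := exact_cycle_inj_syz d cM.
by apply/KP/(pdle_leq (leq_addr j d) pdN).
Qed.

Lemma GProj_exact_cycle m (Y : module_class R) :
  (forall Q : lmodType R, Proj Q -> idle m Q) -> (forall N, Y N -> exists d, pdle d N) ->
  GProj (@Proj R) Y = exact_cycle (@Proj R).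
Proof.
move=> idP pdY; apply/funext => M; apply/propext.
split=> [[P [projP _ cP]]|[P projP cP]]; exists P => //; split=> // N /pdY[d pdN].
apply: Hom_from_exact_ext => L cL.
have cL' : exact_cycle (@Proj R) L by exists P.
exact: (extN_exact_cycle_proj (j := 0) idP cL' pdN).
Qed.

Lemma GInj_exact_cycle (X : module_class R) :
  (forall N, X N -> exists d, pdle d N) ->
  GInj X (@Inj R) = exact_cycle (@Inj R).
Proof.
move=> pdX; apply/funext => M; apply/propext.
split=> [[P [injP _ cP]]|[P injP cP]]; exists P => //; split=> // N /pdX[d pdN].
apply: Hom_to_exact_ext => L cL.
have cL' : exact_cycle (@Inj R) L by exists P.
exact: (extN_exact_cycle_inj (j := 0) cL' pdN).
Qed.

(** If pd(M) <= d.+1 and k <= d, then Ext^(d+1)(M, N) lies between Ext^(d+1)(M, free) = 0 and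
    Ext^(d+2)(M, syz N) = 0, so the bound drops by one. [id_descend] is the dual, embedding the
    first argument in an injective. *)
Lemma pd_descend k d M :
  (forall (Q : lmodType R) j, Proj Q -> (k <= j)%N -> ExtN j M Q) -> pdle d M -> pdle k M.
Proof.
move=> eMQ; elim: d => [|d IHd] pdM; first exact: (pdle_leq (leq0n k)).
have [dk|kd] := ltnP d k; first exact: pdle_leq pdM.
apply: IHd => N; apply: (extN_quo_r (syz_ses N)); last exact: pdM.
by apply: eMQ => //; apply: free_proj.
Qed.

Lemma id_descend k d N :
  (forall (I : lmodType R) j, Inj I -> (k <= j)%N -> ExtN j I N) -> idle d N -> idle k N.
Proof.
move=> eIN; elim: d => [|d IHd] idN; first exact: (idle_leq (leq0n k)).
have [dk|kd] := ltnP d k; first exact: idle_leq idN.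
apply: IHd => M; apply: (extN_sub (cosyz_ses M)); last exact: idN.
by apply: eIN => //; apply: hull_inj.
Qed.

Lemma ExtN_iso_l k G M N (f : {linear G -> M}) :
  iso f -> ExtN k G N -> ExtN k M N.
Proof. by move=> isof; rewrite !extN_cosyz; apply: ext1_iso_l isof. Qed.

(** Dimension shifting in which the cycles [G] replace projectives: they too have no Ext into
    [Q]. *)
Lemma reslen_extN m k j M Q :
  (forall Q : lmodType R, Proj Q -> idle m Q) -> reslen (exact_cycle (@Proj R)) k M ->
  Proj Q -> (k <= j)%N -> ExtN j M Q.
Proof.
move=> idP + projQ; elim: k j M => [|k IHk] j M /=.
  move=> [G [f [cG isof]]] _; apply: (ExtN_iso_l isof).
  apply: (extN_exact_cycle_proj idP cG (@pdle_proj _ 0 _ projQ)).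
move=> [K [G [i [p [cG s /IHk eK]]]]]; case: j => // j kj.
apply: (extN_quo s); first exact: eK.
exact: (extN_exact_cycle_proj idP cG (@pdle_proj _ 0 _ projQ)).
Qed.

Lemma coreslen_extN d k j N I :
  (forall I : lmodType R, Inj I -> pdle d I) -> coreslen (exact_cycle (@Inj R)) k N ->
  Inj I -> (k <= j)%N -> ExtN j I N.
Proof.
move=> pdI + injI; elim: k j N => [|k IHk] j N /=.
  move=> [G [f [cG isof]]] _; apply: (ext1_iso_r isof).
  exact: (extN_exact_cycle_inj cG (pdI _ injI)).
move=> [G [L [i [p [cG s /IHk eL]]]]]; case: j => // j kj.
apply: (extN_sub_r s); first exact: eL.
exact: (extN_exact_cycle_inj cG (pdI _ injI)).
Qed.

End Cycles.

(** * Horseshoe lemmas and Gorenstein dimensions *)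

Section Horseshoe.
Variable R : pzRingType.
Implicit Types A B C D K G L M N P I E : lmodType R.

Lemma inl_linear A B : linear (fun x : A => (x, 0) : A * B).
Proof. by move=> a x y; rewrite -[RHS]/(_, _) /= scaler0 addr0. Qed.
Lemma inr_linear A B : linear (fun x : B => (0, x) : A * B).
Proof. by move=> a x y; rewrite -[RHS]/(_, _) /= scaler0 addr0. Qed.

Definition inl_lin A B : {linear A -> (A * B)%type} := mklin (@inl_linear A B).
Definition inr_lin A B : {linear B -> (A * B)%type} := mklin (@inr_linear A B).

Lemma proj_prod A B : Proj A -> Proj B -> Proj (A * B)%type.
Proof.
move=> pA pB X Y g f sg.
have [h hP] := pA _ _ g (f \o inl_lin A B) sg.
have [k kP] := pB _ _ g (f \o inr_lin A B) sg.
exists ((h \o fst) \+ (k \o snd)) => -[x y].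
rewrite /= linearD hP kP /= -linearD; congr (f _).
by rewrite -[LHS]/(_, _) /= addr0 add0r.
Qed.

Lemma inj_prod A B : Inj A -> Inj B -> Inj (A * B)%type.
Proof.
move=> iA iB X Y g f injg.
have [h hP] := iA _ _ g (fst \o f) injg.
have [k kP] := iB _ _ g (snd \o f) injg.
exists ((inl_lin A B \o h) \+ (inr_lin A B \o k)) => x.
by rewrite /= hP kP /= -[LHS]/(_, _) /= addr0 add0r; case: (f x).
Qed.

(** The syzygy of [A] is prescribed and those of [B] and [C] are constructed, since the use below
    starts from a given syzygy of [A]. A lift [si] of the cover of [C] to [B] gives the second
    component of [be]. *)
Lemma horseshoe A B C (KA PA : lmodType R) (i : {linear A -> B}) (p : {linear B -> C})
    (a : {linear KA -> PA}) (al : {linear PA -> A}) :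
  ses i p -> Proj PA -> ses a al ->
  exists (KB PB KC PC : lmodType R) (b : {linear KB -> PB}) (be : {linear PB -> B})
    (c : {linear KC -> PC}) (ga : {linear PC -> C})
    (j : {linear KA -> KB}) (q : {linear KB -> KC}),
    [/\ Proj PB, Proj PC, ses b be, ses c ga & ses j q].
Proof.
move=> [inji ex sp] projA [inja exa sal].
have projC := @free_proj R C; have sesC := syz_ses C.
have [injc exc sc] := sesC.
have [si siP] := projC _ _ _ (cover C) sp.
pose PB : lmodType R := (PA * free R C)%type.
pose be : {linear PB -> B} := (i \o (al \o fst)) \+ (si \o snd).
have sbe : surjective_map be.
  move=> y; have [z zP] := sc (p y).
  have /ex[x xP] : p (y - si z) = 0 by rewrite linearB siP zP subrr.
  have [w wP] := sal x; exists (w, z).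
  by rewrite /= wP xP subrK.
have sesB := ker_ses sbe; have [injb exb _] := sesB.
have [x|j jP] := factor_ker (f := inl_lin PA (free R C) \o a) injb exb.
  by rewrite /= (ses_comp0 _ exa) !linear0 addr0.
have [x|q qP] := factor_ker (f := snd \o submod_incl (kernel be)) injc exc.
  change (cover C (submod_incl (kernel be) x).2 = 0).
  have := submod_inclP x; case: (submod_incl (kernel be) x) => u v /= e.
  rewrite -siP -[si v](addKr (i (al u))) e addr0.
  by rewrite linearN (ses_comp0 _ ex) oppr0.
exists (submod_lmod (kernel be)), PB, (syz C), (free R C).
exists (submod_incl _), be, (submod_incl _), (cover C), j, q.
split=> //; first exact: proj_prod.
split.
- apply: lin_inj => x /(congr1 (submod_incl (kernel be))).
  by rewrite jP linear0 => -[/=]; rewrite -[0 in RHS](linear0 a) => /inja.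
- move=> x; split=> [qx|[y <-]]; last first.
    by apply: injc; rewrite qP /= jP linear0.
  have := submod_inclP x; have := qP x; rewrite qx linear0 /=.
  case e : (submod_incl (kernel be) x) => [u v] /= v0.
  rewrite -v0 linear0 addr0 -[0 in RHS](linear0 i) => /inji/exa[y yP].
  by exists y; apply: injb; rewrite jP e /= yP -v0.
move=> y; have : p (si (submod_incl _ y)) = 0 by rewrite siP; exact: (submod_inclP y).
move=> /ex[x xP]; have [u uP] := sal x.
have Bu : kernel be (- u, submod_incl _ y).
  by rewrite /= linearN uP linearN xP addNr.
have [z zP] := submod_inclE Bu.
by exists z; apply: injc; rewrite qP /= zP.
Qed.

(** Dually the cosyzygy of [C] is prescribed; [ta] extends the embedding of [A] to [B]. *)
Lemma cohorseshoe A B C (IC LC : lmodType R) (i : {linear A -> B}) (p : {linear B -> C})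
    (c : {linear C -> IC}) (ga : {linear IC -> LC}) :
  ses i p -> Inj IC -> ses c ga ->
  exists (IA LA IB LB : lmodType R) (a : {linear A -> IA}) (al : {linear IA -> LA})
    (b : {linear B -> IB}) (be : {linear IB -> LB})
    (j : {linear LA -> LB}) (q : {linear LB -> LC}),
    [/\ Inj IA, Inj IB, ses a al, ses b be & ses j q].
Proof.
move=> [inji ex sp] injC [injc exc sga].
have injA := @hull_inj R A; have sesA := cosyz_ses A.
have [inja exa sal] := sesA.
have [ta taP] := injA _ _ i (hull_in A) inji.
pose IB : lmodType R := (hull A * IC)%type.
pose b : {linear B -> IB} := (inl_lin _ _ \o ta) \+ (inr_lin _ _ \o (c \o p)).
have bE x : b x = (ta x, c (p x)).
  by rewrite /= -[LHS]/(_, _) /= addr0 add0r.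
have injb : injective b.
  apply: lin_inj => x; rewrite bE => -[tx cx].
  have /ex[y yx] : p x = 0 by apply: injc; rewrite linear0.
  have : hull_in A y = 0 by rewrite -taP yx.
  by rewrite -yx -[0 in RHS](linear0 (hull_in A)) => /inja ->; rewrite linear0.
have sesB := coker_ses injb; have [_ exb sb] := sesB.
pose be := quo_proj (range_submod b).
have [x|j jP] := factor_coker (f := be \o inl_lin (hull A) IC) sal exa.
  rewrite /=; apply/exb; exists (i x).
  by rewrite bE taP (ses_comp0 _ ex) linear0.
have [x|q qP] := factor_coker (f := ga \o snd) sb exb.
  by change (ga (b x).2 = 0); rewrite bE (ses_comp0 _ exc).
exists (hull A), (cosyz A), IB, (quo (range_submod b)).
exists (hull_in A), (quo_proj _), b, be, j, q.
split=> //; first exact: inj_prod.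
split.
- apply: lin_inj => u; have [x <-] := sal u; rewrite jP /= => /exb[y].
  rewrite bE => -[yx cpy].
  have /ex[z zy] : p y = 0 by apply: injc; rewrite linear0.
  by rewrite -yx -zy taP (ses_comp0 _ exa).
- move=> u; have [[x z] <-] := sb u; rewrite qP /=.
  split=> [/exc[w wz]|[v]]; last first.
    have [y <-] := sal v; rewrite jP /= => e.
    by rewrite -[z]/(snd (x, z)) -[ga _]/((ga \o snd) (x, z)) -qP -e qP /= linear0.
  have [y yw] := sp w; exists (quo_proj _ (x - ta y)); rewrite jP /=.
  apply/subr0_eq; rewrite -linearB; apply/exb; exists (- y).
  rewrite bE !linearN yw wz -[RHS]/(_, _) /=.
  by rewrite addrAC subrr !add0r.
move=> y; have [z <-] := sga y; exists (be (0, z)).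
by rewrite qP.
Qed.

(** Arbitrary projectives are allowed, because the horseshoe does not return the canonical [syz]. *)
Fixpoint is_syz k G M : Prop :=
  if k is k'.+1 then exists K P (i : {linear K -> P}) (p : {linear P -> M}),
    [/\ Proj P, ses i p & is_syz k' G K]
  else G = M.

Fixpoint is_cosyz k G M : Prop :=
  if k is k'.+1 then exists I L (i : {linear M -> I}) (p : {linear I -> L}),
    [/\ Inj I, ses i p & is_cosyz k' G L]
  else G = M.

Lemma is_syz_iter k M : is_syz k (iter k (@syz R) M) M.
Proof.
elim: k M => [//|k IHk] M; rewrite iterSr.
exists (syz M), (free R M), (submod_incl _), (cover M).
by split; [exact: free_proj|exact: syz_ses|exact: IHk].
Qed.

Lemma is_cosyz_iter k M : is_cosyz k (iter k (@cosyz R) M) M.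
Proof.
elim: k M => [//|k IHk] M; rewrite iterSr.
exists (hull M), (cosyz M), (hull_in M), (quo_proj _).
by split; [exact: hull_inj|exact: cosyz_ses|exact: IHk].
Qed.

Lemma is_syz_rcons k K P G M (i : {linear K -> P}) (p : {linear P -> G}) :
  Proj P -> ses i p -> is_syz k G M -> is_syz k.+1 K M.
Proof.
move=> projP s; elim: k M => [|k IHk] M.
  by move=> <-; exists K, P, i, p.
move=> [K' [P' [i' [p' [projP' s' /IHk h]]]]].
by exists K', P', i', p'.
Qed.

Lemma is_cosyz_rcons k G I L N (i : {linear G -> I}) (p : {linear I -> L}) :
  Inj I -> ses i p -> is_cosyz k G N -> is_cosyz k.+1 L N.
Proof.
move=> injI s; elim: k N => [|k IHk] N.
  by move=> e; move: i s; rewrite e => i s; exists I, L, i, p.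
move=> [I' [L' [i' [p' [injI' s' /IHk h]]]]].
by exists I', L', i', p'.
Qed.

Lemma is_syz_ext k j G M N : is_syz k G M -> ExtN (k + j) M N <-> ExtN j G N.
Proof.
elim: k M => [|k IHk] M /=; first by move=> ->.
move=> [K [P [i [p [projP s /IHk <-]]]]].
by rewrite addSn (extN_shift_l _ _ projP s).
Qed.

Lemma is_cosyz_ext k j G M N : is_cosyz k G N -> ExtN (k + j) M N <-> ExtN j M G.
Proof.
elim: k N => [|k IHk] N /=; first by move=> ->.
move=> [I [L [i [p [injI s /IHk <-]]]]].
by rewrite addSn (extN_shift_r _ _ injI s).
Qed.

Lemma syz_horseshoe k A B C (i : {linear A -> B}) (p : {linear B -> C}) GA :
  ses i p -> is_syz k GA A ->
  exists (GB GC : lmodType R) (j : {linear GA -> GB}) (q : {linear GB -> GC}),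
    [/\ ses j q, is_syz k GB B & is_syz k GC C].
Proof.
elim: k A B C i p => [|k IHk] A B C i p s /=.
  by move=> ->; exists B, C, i, p.
move=> [KA [PA [a [al [projA sA hA]]]]].
have [KB [PB [KC [PC [b [be [c [ga [j [q [pB pC sB sC sK]]]]]]]]]]] :=
  horseshoe s projA sA.
have [GB [GC [j' [q' [s' hB hC]]]]] := IHk _ _ _ _ _ sK hA.
exists GB, GC, j', q'; split=> //; first by exists KB, PB, b, be.
by exists KC, PC, c, ga.
Qed.

Lemma cosyz_horseshoe k A B C (i : {linear A -> B}) (p : {linear B -> C}) GC :
  ses i p -> is_cosyz k GC C ->
  exists (GA GB : lmodType R) (j : {linear GA -> GB}) (q : {linear GB -> GC}),
    [/\ ses j q, is_cosyz k GA A & is_cosyz k GB B].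
Proof.
elim: k A B C i p => [|k IHk] A B C i p s /=.
  by move=> ->; exists A, B, i, p.
move=> [IC [LC [c [ga [injC sC hC]]]]].
have [IA [LA [IB [LB [a [al [b [be [j [q [iA iB sA sB sL]]]]]]]]]]] :=
  cohorseshoe s injC sC.
have [GA [GB [j' [q' [s' hA hB]]]]] := IHk _ _ _ _ _ sL hC.
exists GA, GB, j', q'; split=> //; first by exists IA, LA, a, al.
by exists IB, LB, b, be.
Qed.

Lemma syz_exact_cycle k M :
  (forall I : lmodType R, Inj I -> pdle k I) ->
  exact_cycle (@Proj R) (iter k (@syz R) M).
Proof.
move=> pdI; apply: (@exact_cycle_coind R _ (fun G => exists M, is_syz k G M)).
(* A syzygy of a k-th syzygy of [N] is a k-th syzygy of a first syzygy of [N]. *)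
- move=> G [N GN]; exists (syz G), (free R G), (submod_incl _), (cover G).
  have /= [K [P [i [p [_ _ sK]]]]] := is_syz_rcons (@free_proj R G) (syz_ses G) GN.
  by split; [exists K|exact: free_proj|exact: syz_ses].
- move=> G [N GN].
  (* The cokernel [GC] is a k-th syzygy of [cosyz N], so the class is preserved. *)
  have [GB [GC [j [q [s hB hC]]]]] := syz_horseshoe (cosyz_ses N) GN.
  exists GB, GC, j, q; split=> //; first by exists (cosyz N).
  apply: proj_of_ext1 => X; apply/(is_syz_ext 0 X hB).
  by rewrite addn0; apply/pdI/hull_inj.
by exists M; apply: is_syz_iter.
Qed.

Lemma cosyz_exact_cycle k M :
  (forall P : lmodType R, Proj P -> idle k P) ->
  exact_cycle (@Inj R) (iter k (@cosyz R) M).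
Proof.
move=> idP; apply: (@exact_cycle_coind R _ (fun G => exists M, is_cosyz k G M)).
- move=> G [N GN].
  have [GA [GB [j [q [s hA hB]]]]] := cosyz_horseshoe (syz_ses N) GN.
  exists GA, GB, j, q; split=> //; first by exists (syz N).
  apply: inj_of_ext1 => X; apply/(is_cosyz_ext 0 X hB).
  by rewrite addn0; apply/idP/free_proj.
- move=> G [N GN]; exists (hull G), (cosyz G), (hull_in G), (quo_proj _).
  have /= [I [L [i [p [_ _ sL]]]]] := is_cosyz_rcons (@hull_inj R G) (cosyz_ses G) GN.
  by split; [exists L|exact: hull_inj|exact: cosyz_ses].
by exists M; apply: is_cosyz_iter.
Qed.

(** Coinduction within the projectives: to the left their syzygies, to the right P -> P -> 0. *)
Lemma proj_exact_cycle P : Proj P -> exact_cycle (@Proj R) P.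
Proof.
apply: exact_cycle_coind => {}P projP.
  exists (syz P), (free R P), (submod_incl _), (cover P).
  split; [|exact: free_proj|exact: syz_ses].
  by apply: proj_of_ext1 => N; apply/(extN_shift_l 0 N (@free_proj R P) (syz_ses P))/pdle_proj.
pose T : lmodType R := 'rV[R]_0.
exists P, T, idfun, (zero_lin P T); split=> //.
  by move=> B C g f sg; exists (zero_lin _ _) => x; rewrite [x]zero_rV !linear0.
split=> //; first by apply: zero_exact => y; exists y.
by move=> y; exists 0; rewrite [y]zero_rV linear0.
Qed.

Lemma inj_exact_cycle I : Inj I -> exact_cycle (@Inj R) I.
Proof.
apply: exact_cycle_coind => {}I injI; last first.
  exists (hull I), (cosyz I), (hull_in I), (quo_proj _).
  split; [|exact: hull_inj|exact: cosyz_ses].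
  by apply: inj_of_ext1 => N; apply/(extN_shift_r 0 N (@hull_inj R I) (cosyz_ses I))/idle_inj.
pose T : lmodType R := 'rV[R]_0.
exists T, I, (zero_lin T I), idfun; split=> //.
  by move=> B C g f sg; exists (zero_lin _ _) => x; apply/esym/zero_rV.
split=> //; first by move=> x y _; rewrite [x]zero_rV [y]zero_rV.
  move=> y; split=> [y0|[x <-]]; last by rewrite [x]zero_rV linear0.
  by exists 0; rewrite linear0; apply: esym y0.
by move=> y; exists y.
Qed.

(** * Comparison of global Gorenstein dimensions with pd(Inj) and id(Proj) *)

Section Equivalences.
Variables (n m : nat).
Hypothesis pdI : forall I : lmodType R, Inj I -> pdle n I.
Hypothesis idP : forall P : lmodType R, Proj P -> idle m P.

(** Either bound kills Ext^(j+1)(I, P) for j >= k, and the other dimension, finite by hypothesis,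
    then descends to k. *)
Lemma pd_inj_iff_id_proj k :
  (forall I : lmodType R, Inj I -> pdle k I) <->
  (forall P : lmodType R, Proj P -> idle k P).
Proof.
split=> [pdk P projP|idk I injI].
  apply: (id_descend _ (idP projP)) => I j injI kj.
  exact: (pdle_leq kj (pdk _ injI)).
apply: (pd_descend _ (pdI injI)) => P j projP kj.
exact: (idle_leq kj (idk _ projP)).
Qed.

(** From left to right, a resolution of an injective by cycles kills its Ext into projectives above
    degree k; as its pd is finite, [pd_descend] applies. *)
Lemma gorenstein_proj_dim k :
  (forall M, exists2 j, (j <= k)%N & reslen (exact_cycle (@Proj R)) j M) <->
  (forall I : lmodType R, Inj I -> pdle k I).
Proof.
split=> [gk I injI|pdk M].
  have [j jk rI] := gk I.
  apply: (pd_descend _ (pdI injI)) => P i projP ki.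
  exact: (reslen_extN idP rI projP (leq_trans jk ki)).
exists k => //; apply: (reslen_syz proj_exact_cycle).
exact: syz_exact_cycle.
Qed.

Lemma gorenstein_inj_dim k :
  (forall M, exists2 j, (j <= k)%N & coreslen (exact_cycle (@Inj R)) j M) <->
  (forall P : lmodType R, Proj P -> idle k P).
Proof.
split=> [gk P projP|idk M].
  have [j jk rP] := gk P.
  apply: (id_descend _ (idP projP)) => I i injI ki.
  exact: (coreslen_extN pdI rP injI (leq_trans jk ki)).
exists k => //; apply: (coreslen_cosyz inj_exact_cycle).
exact: cosyz_exact_cycle.
Qed.

End Equivalences.
End Horseshoe.

(** * Unions of chains of submodules *)

Section Submodules.
Variable R : pzRingType.
Implicit Types A B C M N P : lmodType R.

Lemma corestrict A B (S : submod B) (f : {linear A -> B}) :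
  (forall x, S (f x)) ->
  exists g : {linear A -> submod_lmod S}, forall x, submod_incl S (g x) = f x.
Proof.
move=> Sf; have [|a x y x' y' e e'|y|g gP] :=
    @lin_of_rel R A (submod_lmod S) (fun x y => submod_incl S y = f x).
- by move=> x; apply/submod_inclE/Sf.
- by rewrite !linearP e e'.
- by rewrite linear0 => e; apply: submod_incl_inj; rewrite linear0.
by exists g => x; apply/gP.
Qed.

Definition span A (X : A -> Prop) : submod A.
Proof.
exists (fun x => forall S : submod A, (forall y, X y -> S y) -> S x).
  by move=> S _; apply: submod0.
by move=> a x y Xx Xy S XS; apply: submodP; [apply: Xx|apply: Xy].
Defined.

Lemma span_gen A (X : A -> Prop) x : X x -> span X x.
Proof. by move=> Xx S; apply. Qed.

Lemma span_sub A (X : A -> Prop) (S : submod A) :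
  (forall y, X y -> S y) -> forall x, span X x -> S x.
Proof. by move=> XS x; apply. Qed.

Lemma span_mono A (X Y : A -> Prop) x :
  (forall y, X y -> Y y) -> span X x -> span Y x.
Proof. by move=> XY; apply: span_sub => y /XY; apply: span_gen. Qed.

Lemma free_image (T : choiceType) B (f : {linear free R T -> B}) (S : submod B) :
  (forall t, S (f (free_delta R t))) -> forall x, S (f x).
Proof.
move=> Sf x; have [s us xs] := free_supp x.
rewrite (free_decomp us xs) linear_sum; apply: submod_sum => t.
by rewrite linearZ; apply: submodZ.
Qed.

Section Union.
Variables (A : lmodType R) (k : nat) (J : Type) (S : J -> submod A) (U : submod A).
Hypothesis pd_finite : forall d M, pdle d M -> pdle k M.
Hypothesis pdS : forall j, pdle k (submod_lmod (S j)).
Hypothesis Stot : forall i j, (forall x, S i x -> S j x) \/ (forall x, S j x -> S i x).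
(** Continuity of the chain: the union of a nonempty subfamily is a member or contains [U]. A chain
    of partial lifts then has an upper bound or already gives a lift on [U]. *)
Hypothesis Scup : forall X : J -> Prop, (exists i, X i) ->
  (exists j, forall x, S j x <-> exists2 i, X i & S i x) \/
  (forall x, U x -> exists2 i, X i & S i x).
Hypothesis SU : forall x, U x <-> exists i, S i x.
Variable j0 : J.

Section Lift.
Variables (Y I C : lmodType R) (i : {linear Y -> I}) (q : {linear I -> C}).
Hypothesis sY : ses i q.
Hypothesis eY : forall M, pdle k M -> Ext1 M Y.
Variable g : {linear submod_lmod U -> C}.

(** Elements of [V] and [U] are compared inside [A], which avoids an inclusion map of [V] in [U]. *)
Definition lifts (V : submod A) (h : {linear submod_lmod V -> I}) :=
  forall x u, submod_incl V x = submod_incl U u -> q (h x) = g u.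

Definition partial_lift := {j : J & {h : {linear submod_lmod (S j) -> I} | lifts h}}.

Definition mk_lift j (h : {linear submod_lmod (S j) -> I}) (hh : lifts h) :
  partial_lift := existT _ j (exist (@lifts (S j)) h hh).

(** Only a preorder, as different indices may carry the same submodule; hence [ZL_preorder]
    below. *)
Definition lift_le_prop (s t : partial_lift) :=
  (forall x, S (tag s) x -> S (tag t) x) /\
  forall x y, submod_incl (S (tag s)) x = submod_incl (S (tag t)) y ->
    sval (tagged s) x = sval (tagged t) y.

Definition lift_le : rel partial_lift := fun s t => `[<lift_le_prop s t>].

Lemma lift_le_refl t : lift_le t t.
Proof. by apply/asboolP; split=> // x y /submod_incl_inj ->. Qed.

Lemma lift_le_trans r s t : lift_le r s -> lift_le s t -> lift_le r t.
Proof.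
move=> /asboolP[rs rsh] /asboolP[st sth]; apply/asboolP; split=> [x /rs/st//|x y xy].
have [z zP] := submod_inclE (rs _ (submod_inclP x)).
by rewrite (rsh x z) ?zP // (sth z y) // zP.
Qed.

Lemma lift_restrict (V : submod A) : pdle k (submod_lmod V) ->
  (forall x, V x -> U x) -> exists h : {linear submod_lmod V -> I}, lifts h.
Proof.
move=> pdV VU.
have [e eP] := @corestrict _ _ U (submod_incl V) (fun x => VU _ (submod_inclP x)).
have [h hP] := ext1_lift (g \o e) (eY pdV) sY.
exists h => x u xu; rewrite hP /=; congr (g _).
by apply: submod_incl_inj; rewrite eP.
Qed.

Lemma SjU j x : S j x -> U x.
Proof. by move=> Sx; apply/SU; exists j. Qed.

Lemma lift_glue (X : set partial_lift) (V : submod A) :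
  total_on X lift_le ->
  (forall x, V x -> exists2 t, X t & S (tag t) x) ->
  exists2 h : {linear submod_lmod V -> I}, lifts h &
    forall t, X t -> forall x y, submod_incl (S (tag t)) x = submod_incl V y ->
      sval (tagged t) x = h y.
Proof.
move=> totX VX.
pose r (y : submod_lmod V) z := exists t x, [/\ X t,
  submod_incl (S (tag t)) x = submod_incl V y & sval (tagged t) x = z].
have step (y : submod_lmod V) t t' x : lift_le t t' ->
    submod_incl (S (tag t)) x = submod_incl V y ->
  exists2 w, submod_incl (S (tag t')) w = submod_incl V y &
     sval (tagged t') w = sval (tagged t) x.
  move=> /asboolP[tt' hh'] xy.
  have [w wP] := submod_inclE (tt' _ (submod_inclP x)).
  by exists w; [rewrite wP|rewrite -(hh' x w)].
have [y|a y z y' z'|z|h hP] := @lin_of_rel R _ _ r.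
- have [t Xt St] := VX _ (submod_inclP y).
  have [x xP] := submod_inclE St.
  by exists (sval (tagged t) x), t, x.
- move=> [t [x [Xt xy xz]]] [t' [x' [Xt' xy' xz']]].
  have [tt'|t't] := totX _ _ Xt Xt'.
    have [w wy wz] := step _ _ _ _ tt' xy.
    exists t', (a *: w + x'); split=> //; first by rewrite !linearP wy xy'.
    by rewrite linearP wz xz xz'.
  have [w wy wz] := step _ _ _ _ t't xy'.
  exists t, (a *: x + w); split=> //; first by rewrite !linearP wy xy.
  by rewrite linearP wz xz xz'.
- move=> [t [x [_ x0 <-]]]; rewrite (_ : x = 0) ?linear0 //.
  by apply: submod_incl_inj; rewrite x0 !linear0.
exists h => [y u yu|t Xt x y xy]; last by apply/hP; exists t, x.
have [t [x [Xt xy <-]]] := (hP y (h y)).2 erefl.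
by apply: (svalP (tagged t)); rewrite xy.
Qed.

(** Any lift [h0] on [S j] differs from the given [h] on the smaller submodule by a map into [Y].
    This map extends to [S j], because the quotient has no [Ext1] into [Y], and is subtracted from
    [h0]. *)
Lemma lift_extend t j : (forall x, S (tag t) x -> S j x) ->
  exists2 t', lift_le t t' & tag t' = j.
Proof.
move=> tj; case: t tj => j1 [h hh] /= tj.
have [h0 hh0] := lift_restrict (@pdS j) (@SjU j).
have [e eP] := corestrict (fun x => tj _ (submod_inclP x)).
have inje : injective e.
  by move=> x y /(congr1 (submod_incl _)); rewrite !eP => /submod_incl_inj.
have se := coker_ses inje.
(* The quotient has pd at most [k.+1]; [pd_finite] brings this back to [k]. *)
have pdQ : pdle k (quo (range_submod e)).
  apply: (@pd_finite k.+1) => X; apply: (extN_quo se); first exact: (@pdS _).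
  exact: (pdle_leq (leqnSn k) (@pdS j)).
have [injy exy _] := sY.
have [x|d dP] := factor_ker (f := (h0 \o e) \- h) injy exy.
  have [u uP] := submod_inclE (@SjU j1 _ (submod_inclP x)).
  by rewrite /= linearB /= (hh0 _ u) ?eP // (hh _ u) // subrr.
have [d' d'P] := eY pdQ se d.
have h'h : lifts (h0 \- (i \o d')).
  move=> x u xu; rewrite /= linearB /= (ses_comp0 _ exy) subr0.
  exact: hh0.
exists (mk_lift h'h) => //.
apply/asboolP; split=> //= x y xy.
have <- : e x = y by apply: submod_incl_inj; rewrite eP.
by rewrite d'P dP /= opprB addrC subrK.
Qed.

Lemma union_lift : exists h : {linear submod_lmod U -> I}, forall u, q (h u) = g u.
Proof.
suff [h hh] : exists h : {linear submod_lmod U -> I}, lifts h.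
  by exists h => u; apply: hh.
(* This excludes the second alternative of [Scup], so that Zorn's lemma applies. *)
apply: contrapT => nolift.
have [h0 hh0] := lift_restrict (@pdS j0) (@SjU j0).
pose t0 : partial_lift := mk_lift hh0.
have [|t tmax] := ZL_preorder t0 lift_le_refl lift_le_trans.
  move=> X totX; have [[t1 Xt1]|X0] := pselect (exists t, X t); last first.
    by exists t0 => s Xs; case: X0; exists s.
  have [|[j jP]|UX] := Scup (X := fun j => exists2 t, X t & tag t = j).
  - by exists (tag t1), t1.
  - have [x|h hh hP] := lift_glue (V := S j) totX.
      by move=> /jP[_ [t Xt <-] St]; exists t.
    exists (mk_lift hh) => s Xs; apply/asboolP; split.
      by move=> x Sx; apply/jP; exists (tag s) => //; exists s.
    exact: hP.
  - case: nolift; have [x|h hh _] := lift_glue (V := U) totX; last by exists h.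
    by move=> /UX[_ [t Xt <-] St]; exists t.
apply: nolift; have [allS|] := pselect (forall j x, S j x -> S (tag t) x).
  have [||h hh _] := @lift_glue [set t]%classic U; last by exists h.
    by move=> _ _ -> ->; left; apply: lift_le_refl.
  by move=> x /SU[j /allS Sx]; exists t.
move=> /existsNP[j nj]; have [tj|//] := Stot (tag t) j.
have [t' tt' t'j] := lift_extend tj.
by have /asboolP[t't _] := tmax _ tt'; case: nj; rewrite -t'j.
Qed.

End Lift.

Lemma pdle_union : pdle k (submod_lmod U).
Proof.
move=> N; apply/extN_cosyz.
apply: (ext1_of_lift (@hull_inj R _) (cosyz_ses _)) => g.
apply: (union_lift (cosyz_ses _)) => M pdM.
exact/extN_cosyz.
Qed.

End Union.
End Submodules.

(** * Relations in flat modules *)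

(* The equational criterion for flatness, for a system of relations.  With I the
   right submodule of R^k spanned by the columns of A, the tensor product of I
   and F is F^n modulo the combinations l x with A l = 0, the tensor product of
   R^k and F is F^k, and the map between them is induced by A. *)
Section FlatRelation.
Variables (R : pzRingType) (F : lmodType R) (k n : nat).
Variable A : 'I_k -> 'I_n -> R.

(** Columns as a right [R]-module: scalars of [(R^c)^o] act by right multiplication in [R]. *)
Definition rightvec m : lmodType R^c := 'I_m -> (R^c)^o.

Definition colmap (l : rightvec n) : rightvec k :=
  fun i => \sum_j A i j * (l j : R).

Lemma colmap_linear : linear colmap.
Proof.
move=> r x y; apply/funext => i.
change (\sum_j A i j * ((x j : R) * r + (y j : R)) =
  (\sum_j A i j * (x j : R)) * r + \sum_j A i j * (y j : R)).
rewrite mulr_suml -big_split; apply: eq_bigr => j _ /=.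
by rewrite mulrDr mulrA.
Qed.

Definition colmap_lin : {linear rightvec n -> rightvec k} := mklin colmap_linear.
Definition colspace : submod (rightvec k) := range_submod colmap_lin.

Definition unit_vec m (j : 'I_m) : rightvec m := fun i => (i == j)%:R.

Definition leftvec m : zmodType := 'I_m -> F.

Definition vec_tensor m (v : rightvec m) (x : F) : leftvec m :=
  fun i => (v i : R) *: x.

Lemma rightvec_sum m I (s : seq I) (v : I -> rightvec m) i :
  (\sum_(t <- s) v t) i = \sum_(t <- s) (v t i : R).
Proof. by rewrite fct_sumE. Qed.

Lemma leftvec_sum m I (s : seq I) (v : I -> leftvec m) i :
  (\sum_(t <- s) v t) i = \sum_(t <- s) v t i.
Proof. by rewrite fct_sumE. Qed.

Section Balanced.
Variables (B : lmodType R^c) (U : zmodType) (b : B -> F -> U).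
Hypothesis bal : balanced b.

Lemma balanced0l x : b 0 x = 0.
Proof.
have [bD _ _] := bal; have := bD 0 0 x.
by rewrite addr0 -[X in X = _]addr0 => /addrI.
Qed.

Lemma balanced_sum I (s : seq I) (a : I -> B) x :
  b (\sum_(t <- s) a t) x = \sum_(t <- s) b (a t) x.
Proof.
have [bD _ _] := bal.
by elim/big_rec2: _ => [|t y1 y2 _ <-]; [apply: balanced0l|apply: bD].
Qed.

Lemma balancedBr a x y : b a (x - y) = b a x - b a y.
Proof.
have [_ bD _] := bal; apply/(addIr (b a y)).
by rewrite -bD !subrK.
Qed.
End Balanced.

Lemma vec_tensor_balanced m : balanced (@vec_tensor m).
Proof.
split=> [a a' x|a x x'|r a x]; apply/funext => i.
- exact: scalerDl.
- exact: scalerDr.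
- exact/esym/scalerA.
Qed.

Lemma vec_decomp m (v : rightvec m) : v = \sum_j ((v j : R^c) *: unit_vec j).
Proof.
apply/funext => i; rewrite rightvec_sum (bigD1 i) //= big1 ?addr0 => [|j ji].
  by change (v i = ((i == i)%:R : R) * (v i : R)); rewrite eqxx mul1r.
by change (((i == j)%:R : R) * (v j : R) = 0); rewrite eq_sym (negPf ji) mul0r.
Qed.

Lemma leftvec_decomp m (w : leftvec m) : w = \sum_j vec_tensor (unit_vec j) (w j).
Proof.
apply/funext => i; rewrite leftvec_sum (bigD1 i) //= big1 ?addr0 => [|j ji].
  by rewrite /vec_tensor /unit_vec eqxx scale1r.
by rewrite /vec_tensor /unit_vec eq_sym (negPf ji) scale0r.
Qed.

Lemma vec_tensorP m : is_tensor_product (@vec_tensor m).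
Proof.
split=> [|U b bal]; first exact: vec_tensor_balanced.
have [bDl _ bZ] := bal.
have ah : zmod_morphism (fun w : leftvec m => \sum_i b (unit_vec i) (w i)).
  by move=> x y; rewrite -sumrB; apply: eq_bigr => i _; apply: balancedBr.
exists (mkadd ah); split=> [v x|h' h'P w] /=.
  rewrite [in RHS](vec_decomp v) (balanced_sum bal).
  by apply: eq_bigr => i _; rewrite -bZ.
rewrite [in LHS](leftvec_decomp w) raddf_sum.
by apply: eq_bigr => i _; apply: h'P.
Qed.

Definition rel_sum (s : seq (rightvec n * F)) : leftvec n :=
  \sum_(u <- s) vec_tensor u.1 u.2.

Definition rel_subgrp : subgrp (leftvec n).
Proof.
exists (fun w => exists2 s : seq (rightvec n * F),
    forall u, u \in s -> colmap_lin u.1 = 0 & w = rel_sum s).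
  by exists [::] => //; rewrite /rel_sum big_nil.
move=> _ _ [s sP ->] [s' s'P ->].
exists (s ++ [seq (u.1, - u.2) | u <- s']).
  move=> u; rewrite mem_cat => /orP[/sP//|/mapP[v /s'P v0 ->]]; exact: v0.
rewrite /rel_sum big_cat big_map /= -sumrN; congr (_ + _).
by apply: eq_bigr => u _; apply/funext => i; apply/esym/scalerN.
Defined.

Definition col_tensor : zmodType := quo_type rel_subgrp.

Lemma colspace_lift (a : submod_lmod colspace) :
  exists l, colmap_lin l = submod_incl colspace a.
Proof. exact: (submod_inclP a). Qed.

Definition col_coef (a : submod_lmod colspace) : rightvec n :=
  projT1 (cid (colspace_lift a)).

Lemma col_coefP a : colmap_lin (col_coef a) = submod_incl colspace a.
Proof. exact: (projT2 (cid (colspace_lift a))). Qed.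

Definition col_pair (a : submod_lmod colspace) (x : F) : col_tensor :=
  quo_pi rel_subgrp (vec_tensor (col_coef a) x).

(** Two preimages of [a] differ by a solution of A l = 0, which the quotient kills. *)
Lemma col_pairE a x l : colmap_lin l = submod_incl colspace a ->
  col_pair a x = quo_pi rel_subgrp (vec_tensor l x).
Proof.
move=> la; apply/quo_piP; exists [:: (col_coef a - l, x)].
  move=> u; rewrite inE => /eqP ->; change (colmap_lin (col_coef a - l) = 0).
  by rewrite linearB la col_coefP subrr.
rewrite /rel_sum big_seq1; apply/funext => i.
exact/esym/scalerBl.
Qed.

Lemma col_pair_balanced : balanced col_pair.
Proof.
split=> [a a' x|a x x'|r a x].
- rewrite (@col_pairE _ _ (col_coef a + col_coef a')); last first.
    by rewrite !linearD !col_coefP.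
  rewrite /col_pair -raddfD; congr quo_pi; apply/funext => i; exact: scalerDl.
- rewrite /col_pair -raddfD; congr quo_pi; apply/funext => i; exact: scalerDr.
rewrite (@col_pairE _ _ ((r : R^c) *: col_coef a)); last first.
  by rewrite [LHS]linearZ col_coefP linearZ.
by rewrite /col_pair; congr quo_pi; apply/funext => i; apply/esym/scalerA.
Qed.

Lemma column_exists j : exists a : submod_lmod colspace,
  submod_incl colspace a = colmap_lin (unit_vec j).
Proof. by apply: submod_inclE; exists (unit_vec j). Qed.

Definition column j : submod_lmod colspace := projT1 (cid (column_exists j)).

Lemma columnE j : submod_incl colspace (column j) = colmap_lin (unit_vec j).
Proof. exact: (projT2 (cid (column_exists j))). Qed.

Lemma column_sum l : submod_incl colspace (\sum_j (l j : R^c) *: column j) = colmap_lin l.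
Proof.
rewrite [in RHS](vec_decomp l) !linear_sum; apply: eq_bigr => j _.
by rewrite [RHS]linearZ linearZ columnE.
Qed.

Lemma col_pairP : is_tensor_product col_pair.
Proof.
split=> [|U b bal]; first exact: col_pair_balanced.
have [bDl _ bZ] := bal.
(* The map induced by [b] is read off on the columns. It kills [rel_subgrp], since A l = 0 says that
   the combination of columns with coefficients [l] is zero. *)
have ah0 : zmod_morphism (fun w : leftvec n => \sum_j b (column j) (w j)).
  by move=> x y; rewrite -sumrB; apply: eq_bigr => i _; apply: balancedBr.
have hE l x : mkadd ah0 (vec_tensor l x) = b (\sum_j (l j : R^c) *: column j) x.
  rewrite /= (balanced_sum bal).
  by apply: eq_bigr => j _; rewrite -bZ.
have [w [s sP ->]|h hP] := quo_additive (S := rel_subgrp) (f := mkadd ah0).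
  rewrite /rel_sum raddf_sum big_seq big1 // => u /sP u0.
  rewrite hE (_ : \sum_j _ = 0) ?balanced0l //.
  by apply: submod_incl_inj; rewrite column_sum u0 linear0.
exists h; split=> [a x|h' h'P u].
  rewrite hP hE; congr b; apply: submod_incl_inj.
  by rewrite column_sum col_coefP.
have [w <-] := quo_pi_surj u; rewrite hP [in LHS](leftvec_decomp w).
rewrite !raddf_sum; apply: eq_bigr => j _ /=.
by rewrite -h'P (col_pairE _ (esym (columnE j))).
Qed.

Lemma flat_relation (x : 'I_n -> F) : Flat F ->
  (forall i, \sum_j A i j *: x j = 0) ->
  exists2 s : seq (('I_n -> R) * F),
    forall u, u \in s -> forall i, \sum_j A i j * u.1 j = 0 &
    forall j, x j = \sum_(u <- s) u.1 j *: u.2.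
Proof.
move=> flatF x0.
have ah0 : zmod_morphism (fun w : leftvec n =>
    ((fun i => \sum_j A i j *: w j) : leftvec k)).
  move=> v w; apply/funext => i.
  change (\sum_j A i j *: (v j - w j) =
    \sum_j A i j *: v j - \sum_j A i j *: w j).
  by rewrite -sumrB; apply: eq_bigr => j _; rewrite scalerBr.
have hE l y : mkadd ah0 (vec_tensor l y) = vec_tensor (colmap_lin l) y.
  apply/funext => i /=; rewrite /vec_tensor scaler_suml.
  by apply: eq_bigr => j _; rewrite scalerA.
have [w [s sP ->]|h hP] := quo_additive (S := rel_subgrp) (f := mkadd ah0).
  rewrite /rel_sum raddf_sum big_seq big1 // => u /sP u0.
  by rewrite hE u0; apply/funext => i; apply: scale0r.
(* [h] is the inclusion of the column space in R^k tensored with [F]; the vector [x] represents an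
   element of its kernel. *)
have injh : injective h.
  apply: (flatF _ _ (submod_incl colspace) (@submod_incl_inj _ _ _) _ _ _ _
    col_pairP (@vec_tensorP k)) => a y.
  by rewrite hP hE col_coefP.
have : quo_pi rel_subgrp (x : leftvec n) = 0.
  by apply: injh; rewrite hP raddf0; apply/funext => i; apply: x0.
move=> /quo_pi_eq0[s sP xE]; exists s => [u /sP u0 i|j].
  exact: (congr1 (fun f : rightvec k => f i) u0).
by rewrite xE /rel_sum leftvec_sum.
Qed.

End FlatRelation.

(** * Flat modules have finite projective dimension *)

Section Splitting.
Variables (R : pzRingType).
Implicit Types A B C M N P : lmodType R.

(* For P projective, this is purity of K in P. *)
Definition locally_split (K P : lmodType R) (i : {linear K -> P}) :=
  forall l : seq K, exists (r : {linear P -> K}) (g : seq K),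
    (forall x, x \in l -> r (i x) = x) /\ forall y, span (fun z => z \in g) (r y).

Lemma common_supp (T : choiceType) (l : seq (free R T)) :
  exists2 s, uniq s & forall x, x \in l -> forall t, t \notin s -> free_coef x t = 0.
Proof.
elim: l => [|x l [s us sP]]; first by exists [::].
have [s' us' s'P] := free_supp x.
exists (undup (s ++ s')) => [|y]; first exact: undup_uniq.
rewrite inE => yl t; rewrite mem_undup mem_cat negb_or => /andP[ts ts'].
by case/orP: yl => [/eqP ->|/sP]; [apply: s'P|apply].
Qed.

(** The elements of [l] have finite common support e_j, and their coefficients A are relations among
    the e_j in [F]. Flatness writes e_j as a sum of v_j y_v with A v = 0. Let [r] send the basis
    element of e_j to b_j, itself minus the sum of v_j times the basis elements of the y_v, and the
    others to 0. Then b_j is in the kernel, and A v = 0 makes [r] fix [l]. *)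
Lemma flat_locally_split (F : lmodType R) :
  Flat F -> locally_split (submod_incl (kernel (cover F))).
Proof.
move=> flatF l; set i := submod_incl _.
have [s us sP] := common_supp [seq i x | x <- l].
pose n := size s; pose k := size l.
pose e (j : 'I_n) : F := nth 0 s j.
pose A (t : 'I_k) (j : 'I_n) : R := free_coef (i (nth 0 l t)) (e j).
have lsum x : x \in l -> i x = \sum_(j < n) free_coef (i x) (e j) *: free_delta R (e j).
  move=> xl; rewrite {1}(free_decomp us (x := i x)) => [|t ts].
    by rewrite (big_nth 0) big_mkord.
  by apply: (sP _ _ _ ts); apply: map_f.
have [u uP eE] : exists2 u : seq (('I_n -> R) * F),
    forall v, v \in u -> forall t, \sum_j A t j * v.1 j = 0 &
    forall j, e j = \sum_(v <- u) v.1 j *: v.2.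
  apply: flat_relation => // t.
  have cz : cover F (i (nth 0 l t)) = 0 := submod_inclP l`_t.
  rewrite -[RHS]cz [in RHS]lsum ?mem_nth // linear_sum; apply: eq_bigr => j _.
  by rewrite linearZ cover_delta.
pose b j := free_delta R (e j) - \sum_(v <- u) v.1 j *: free_delta R v.2.
have bK j : exists y, i y = b j.
  apply: submod_inclE; change (cover F (b j) = 0).
  rewrite linearB cover_delta linear_sum [X in X - _]eE -sumrB big1 // => v _.
  by rewrite linearZ cover_delta subrr.
have [c cP] := choice bK.
pose c' (t : F) : syz F := if insub (index t s) is Some j then c j else 0.
have [r rP] := free_ext c'.
exists r, [seq c j | j <- enum 'I_n]; split=> [x xl|]; last first.
  apply: free_image => t; rewrite rP /c'; case: insubP => [j _ _|_].
    by apply: span_gen; apply: map_f; rewrite mem_enum.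
  exact: submod0.
have c'e j : c' (e j) = c j.
  rewrite /c' /e index_uniq //; case: insubP => [j' _ e'|]; last by rewrite ltn_ord.
  by congr c; apply: val_inj.
apply: (@submod_incl_inj _ _ (kernel (cover F))); rewrite -/i.
rewrite [in RHS](lsum x xl) {1}(lsum x xl) linear_sum linear_sum.
under eq_bigr => j _ do rewrite !linearZ rP c'e cP /b /= scalerBr.
rewrite sumrB [X in _ - X](_ : _ = 0) ?subr0 //.
under eq_bigr do rewrite scaler_sumr.
rewrite exchange_big big_seq big1 //= => v vu.
under eq_bigr do rewrite scalerA.
rewrite -scaler_suml.
have xk : (index x l < k)%N by rewrite index_mem.
have := uP v vu (Ordinal xk); rewrite /A /= nth_index // => ->.
exact: scale0r.
Qed.

(** * Closure under local retractions *)

Section Closure.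
Variables (K P : lmodType R) (i : {linear K -> P}).
Variables (r : seq K -> {linear P -> K}) (g : seq K -> seq K).
Hypothesis rP : forall l x, x \in l -> r l (i x) = x.
Hypothesis gP : forall l y, span (fun z => z \in g l) (r l y).

Fixpoint lists n (l : seq K) : seq (seq K) :=
  if n is n'.+1 then [seq x :: t | x <- l, t <- lists n' l] ++ lists n' l
  else [:: [::]].

Lemma lists_mem n l t : (size t <= n)%N -> {subset t <= l} -> t \in lists n l.
Proof.
elim: n t => [|n IHn] [|x t] // tn tl; rewrite /= mem_cat; apply/orP.
  by right; apply: IHn.
left; apply/allpairsP; exists (x, t); split=> //.
  by apply: tl; rewrite mem_head.
by apply: IHn => // y yt; apply: tl; rewrite inE yt orbT.
Qed.

Lemma lists_sub n l t : t \in lists n l -> {subset t <= l}.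
Proof.
elim: n t => [|n IHn] t /=; first by rewrite inE => /eqP ->.
rewrite mem_cat => /orP[/allpairsP[[x t'] /= [xl /IHn t'l ->]]|/IHn//].
by move=> y; rewrite inE => /orP[/eqP ->|/t'l].
Qed.

(** Levels stay finite, so each has its own map [r]. The length bound is at least [n], so that every
    finite list in the closure is eventually treated, and at least [size l], so that [g l] itself
    enters at once. *)
Fixpoint level (s : seq K) n : seq K :=
  if n is n'.+1 then
    let l := level s n' in
    l ++ flatten [seq g t | t <- lists (maxn n (size l)) l]
  else s.

(* The least set containing s and closed under l |-> g l on finite lists. *)
Definition clos s x := exists n, x \in level s n.

Lemma level_leq s m n : (m <= n)%N -> {subset level s m <= level s n}.
Proof.
move=> /subnK <-; elim: (n - m)%N => // d IHd x /IHd.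
by rewrite /= mem_cat => ->.
Qed.

Lemma level_next s n x : x \in g (level s n) -> x \in level s n.+1.
Proof.
move=> xg; rewrite /= mem_cat; apply/orP; right; apply/flattenP.
exists (g (level s n)) => //; apply: map_f; apply: lists_mem => //.
exact: leq_maxr.
Qed.

Lemma clos_level s (t : seq K) : (forall x, x \in t -> clos s x) ->
  exists n, {subset t <= level s n}.
Proof.
elim: t => [|x t IHt] tP; first by exists 0%N.
have [|n nP] := IHt; first by move=> y yt; apply: tP; rewrite inE yt orbT.
have [m mP] := tP x (mem_head _ _).
exists (maxn m n) => y; rewrite inE => /orP[/eqP ->|/nP].
  exact: level_leq (leq_maxl _ _) _ mP.
exact: level_leq (leq_maxr _ _) _.
Qed.

Lemma clos_closed s t : (forall x, x \in t -> clos s x) ->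
  forall z, z \in g t -> clos s z.
Proof.
move=> /clos_level[n nP] z zg; pose m := maxn n (size t).
exists m.+1; rewrite /= mem_cat; apply/orP; right; apply/flattenP.
exists (g t) => //; apply: map_f; apply: lists_mem.
  by rewrite leq_max (leq_trans (leq_maxr n (size t))).
by move=> x /nP; apply: level_leq; apply: leq_maxl.
Qed.

Lemma clos_gen s x : x \in s -> clos s x.
Proof. by move=> xs; exists 0%N. Qed.

Lemma clos_sub s s' : (forall x, x \in s -> clos s' x) ->
  forall x, clos s x -> clos s' x.
Proof.
move=> ss' x [n]; elim: n x => [|n IHn] x; first exact: ss'.
rewrite [level _ _.+1]/= mem_cat => /orP[/IHn//|/flattenP[_ /mapP[t tl ->]]].
apply: clos_closed => y yt; apply: IHn.
exact: lists_sub tl _ yt.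
Qed.

Let Lv s n := span (fun z => z \in level s n).

Lemma span_closE s x : span (clos s) x <-> exists n, Lv s n x.
Proof.
split=> [|[n]]; last by apply: span_mono => y yn; exists n.
have mono m n y : (m <= n)%N -> Lv s m y -> Lv s n y.
  by move=> mn; apply: span_mono; apply: level_leq.
have S0 : exists n, Lv s n 0 by exists 0%N; apply: submod0.
have SD a y z : (exists n, Lv s n y) -> (exists n, Lv s n z) ->
    exists n, Lv s n (a *: y + z).
  move=> [m ym] [n zn]; exists (maxn m n); apply: submodP.
    exact: mono (leq_maxl _ _) ym.
  exact: mono (leq_maxr _ _) zn.
apply: (span_sub (S := Submod S0 SD)) => y [n yn].
by exists n; apply: span_gen.
Qed.

Lemma level_retract s n x : Lv s n x -> r (level s n) (i x) = x.
Proof.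
have S0 : r (level s n) (i 0) = 0 by rewrite !linear0.
have SD a y z : r (level s n) (i y) = y -> r (level s n) (i z) = z ->
    r (level s n) (i (a *: y + z)) = a *: y + z.
  by rewrite !linearP => -> ->.
by apply: (span_sub (S := Submod S0 SD)) => y; apply: rP.
Qed.

Lemma level_image s n y : Lv s n.+1 (r (level s n) y).
Proof. by move: (@gP (level s n) y); apply: span_mono => z; apply: level_next. Qed.

(* Lifts along the retractions at consecutive levels are corrected so as to
   agree on the spans of the levels. *)
Lemma span_clos_proj s : Proj P -> Proj (submod_lmod (span (clos s))).
Proof.
move=> projP; set L := span (clos s) => B C p f sp.
have iL n x : Lv s n x -> L x by move=> xn; apply/span_closE; exists n.
have /choice[q qP] : forall n, exists q : {linear P -> submod_lmod L},
    forall y, submod_incl L (q y) = r (level s n) y.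
  by move=> n; apply: corestrict => y; apply/iL/level_image.
pose ok n (k : {linear P -> B}) := forall y, p (k y) = f (q n y).
have /choice[st stP] : forall nk : nat * {linear P -> B},
    exists k' : {linear P -> B}, ok nk.1 nk.2 -> ok nk.1.+1 k' /\
      forall x, Lv s nk.1 x -> k' (i x) = nk.2 (i x).
  move=> [n k]; have [h hP] := projP _ _ _ (f \o q n.+1) sp.
  (* [w] fixes the image of the n-th level, so the corrected lift agrees with [k] there; the
     correction is killed by [p], because [q n.+1 \o w] equals [q n]. *)
  pose w := i \o r (level s n) : {linear P -> P}.
  exists (h \+ (k \- (h \o w))) => /= kP; split=> [y|x xn].
    rewrite /= linearD linearB /= !hP /= kP.
    have -> : q n.+1 (i (r (level s n) y)) = q n y.
      apply: submod_incl_inj; rewrite !qP.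
      exact/level_retract/level_image.
    by rewrite subrr addr0.
  by rewrite /= level_retract // addrC subrK.
have [k0 k0P] := projP _ _ _ (f \o q 0%N) sp.
pose k := fix k n := if n is n'.+1 then st (n', k n') else k0.
have kok n : ok n (k n).
  by elim: n => [|n IHn]; [apply: k0P|have [] := stP (n, k n) IHn].
have kS n x : Lv s n x -> k n.+1 (i x) = k n (i x).
  by have [_] := stP (n, k n) (kok n); apply.
have mono m n y : (m <= n)%N -> Lv s m y -> Lv s n y.
  by move=> mn; apply: span_mono; apply: level_leq.
have kE m n x : (m <= n)%N -> Lv s m x -> k n (i x) = k m (i x).
  move=> /subnK <- xm; elim: (n - m)%N => [//|d IHd].
  by rewrite addSn kS //; apply: mono xm; apply: leq_addl.
have [x|a x y x' y' [m [xm ->]] [n [xn ->]]|y [n [_ ->]]|h hP] :=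
  @lin_of_rel R (submod_lmod L) B
    (fun x y => exists n, Lv s n (submod_incl L x) /\ y = k n (i (submod_incl L x))).
- have /span_closE[n xn] := submod_inclP x.
  by exists (k n (i (submod_incl L x))), n.
- exists (maxn m n); rewrite !linearP; split.
    apply: submodP; first exact: mono (leq_maxl _ _) xm.
    exact: mono (leq_maxr _ _) xn.
  by rewrite (kE m (maxn m n)) ?leq_maxl // (kE n (maxn m n)) ?leq_maxr.
- by rewrite !linear0.
exists h => x; have [n [xn ->]] := (hP x (h x)).2 erefl.
rewrite kok; congr (f _); apply: submod_incl_inj.
by rewrite qP level_retract.
Qed.

(** For infinite [X], the union over finite subsets, which is directed by [clos_sub]. *)
Definition set_clos (X : K -> Prop) : submod K.
Proof.
exists (fun x => exists2 s, forall y, y \in s -> X y & span (clos s) x).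
  by exists [::] => //; apply: submod0.
move=> a x y [s sX xs] [s' s'X ys']; exists (s ++ s').
  by move=> z; rewrite mem_cat => /orP[/sX|/s'X].
apply: submodP; [apply: span_mono xs|apply: span_mono ys'];
  apply: clos_sub => z zs; apply: clos_gen; rewrite mem_cat zs ?orbT //.
Defined.

Lemma set_clos_mono (X Y : K -> Prop) x :
  (forall y, X y -> Y y) -> set_clos X x -> set_clos Y x.
Proof. by move=> XY [s sX xs]; exists s => // y /sX/XY. Qed.

Lemma set_clos_ext (X Y : K -> Prop) :
  (forall y, X y <-> Y y) -> set_clos X = set_clos Y.
Proof. by move=> XY; congr set_clos; apply/funext => y; apply/propext. Qed.

Lemma set_clos_seq s x : set_clos (fun y => y \in s) x <-> span (clos s) x.
Proof.
split=> [[s' s's]|xs]; last by exists s.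
by apply: span_mono; apply: clos_sub => y /s's/clos_gen.
Qed.

Lemma submod_eq (S T : submod K) : (forall x, S x <-> T x) -> S = T.
Proof.
case: S T => [S S0 SP] [T T0 TP] /= ST.
have e : S = T by apply/funext => x; apply/propext.
case: _ / e T0 TP {ST} => T0 TP.
by congr Submod; apply: Prop_irrelevance.
Qed.

Variable k : nat.
Hypothesis pd_finite : forall d M, pdle d M -> pdle k M.
Hypothesis projP : Proj P.

(** * Transfinite induction along a well-ordering *)

Variable le : rel K.
Hypothesis wo_le : well_order le.

Lemma wo_min (X : K -> Prop) : (exists x, X x) ->
  exists2 x, X x & forall y, X y -> le x y.
Proof.
move=> [x Xx]; have [|z [[/asboolP Xz zmin] _]] := wo_le (A := fun y => `[<X y>]).
  by exists x; apply/asboolP.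
by exists z => // y Xy; apply: zmin; apply/asboolP.
Qed.

Lemma wo_total : total le.
Proof.
have /wo_chainW tot : wo_chain le predT by move=> X _; apply: wo_le.
by move=> x y; apply: tot.
Qed.

Lemma wo_anti x y : le x y -> le y x -> x = y.
Proof.
have /wo_chain_antisymmetric anti : wo_chain le predT by move=> X _; apply: wo_le.
by move=> xy yx; apply: anti => //; rewrite xy.
Qed.

Lemma wo_trans y x z : le x y -> le y z -> le x z.
Proof.
move=> xy yz; have [|t Xt tmin] := wo_min (X := fun t => [\/ t = x, t = y | t = z]).
  by exists x; constructor 1.
have tx : le t x by apply: tmin; constructor 1.
have ty : le t y by apply: tmin; constructor 2.
have tz : le t z by apply: tmin; constructor 3.
case: Xt => tE; rewrite tE in tx ty tz => //.
  by rewrite (wo_anti xy tx).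
by rewrite -(wo_anti yz ty).
Qed.

(** The bound comes first, so that [seg t] is the initial segment below [t]. *)
Definition seg (t s : K) := le s t /\ s <> t.

Lemma seg_trans s t u : seg s u -> seg t s -> seg t u.
Proof.
move=> [us nus] [st nst]; split; first exact: wo_trans st.
by move=> ut; apply: nus; apply: wo_anti => //; rewrite ut.
Qed.

Lemma seg_or_le s t : seg t s \/ le t s.
Proof.
have /orP[st|] := wo_total s t; last by right.
have [->|n] := pselect (s = t); last by left.
by right; have := wo_total t t; rewrite orbb.
Qed.

Lemma seg_not_le s t : seg t s -> le t s -> False.
Proof. by move=> [st n] ts; apply: n; apply: wo_anti. Qed.

Lemma wo_ind (Q : K -> Prop) :
  (forall t, (forall s, seg t s -> Q s) -> Q t) -> forall t, Q t.
Proof.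
move=> IH t; apply: contrapT => nQt.
have [|m nQm mmin] := wo_min (X := fun s => ~ Q s); first by exists t.
apply: nQm; apply: IH => s sm; apply: contrapT => /mmin.
exact: seg_not_le.
Qed.

Let SC (D : K -> Prop) (Y : seq K) := set_clos (fun y => D y \/ y \in Y).

(* The finite set Y absorbs the top element of D when D has one, so that a
   closed set is only ever extended by unions of chains. *)
Lemma pdle_initial (D : K -> Prop) :
  (forall s t, D t -> seg t s -> D s) ->
  (forall t, D t -> forall Y, pdle k (submod_lmod (SC (seg t) Y))) ->
  forall Y, pdle k (submod_lmod (SC D Y)).
Proof.
move=> Ddown IH Y.
have [[t [Dt tmax]]|nomax] := pselect (exists t, D t /\ forall s, D s -> le s t).
  rewrite (_ : SC D Y = SC (seg t) (t :: Y)); first exact: IH.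
  apply: set_clos_ext => y; rewrite inE; split.
    case=> [Dy|->]; last by right; rewrite orbT.
    have [->|n] := pselect (y = t); first by right; rewrite eqxx.
    by left; split=> //; apply: tmax.
  by case=> [/(Ddown _ _ Dt)|/orP[/eqP ->|]]; [left|left|right].
have next s : D s -> exists2 t, D t & seg t s.
  move=> Ds; apply: contrapT => nt; apply: nomax; exists s; split=> // t Dt.
  by have [st|//] := seg_or_le s t; case: nt; exists t.
have [[d0 Dd0]|D0] := pselect (exists d, D d); last first.
  rewrite (_ : SC D Y = span (clos Y)).
    by apply: pdle_proj; apply: span_clos_proj.
  apply: submod_eq => x; rewrite -set_clos_seq /SC; split; apply: set_clos_mono.
    by move=> y [Dy|//]; case: D0; exists y.
  by move=> y; right.
pose J := {t | D t}; pose S (j : J) := SC (seg (sval j)) Y.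
have Smono (s t : K) x : le s t -> SC (seg s) Y x -> SC (seg t) Y x.
  move=> st; apply: set_clos_mono => y [[ys nys]|]; last by right.
  left; split; first exact: wo_trans st.
  by move=> yt; apply: nys; apply: wo_anti => //; rewrite yt.
(* Closures are built from finite lists, and a finite part of a union of segments lies in one of
   them. So closure commutes with these unions. *)
have fin (X : K -> Prop) (l : seq K) : (exists t, X t) -> (forall t, X t -> D t) ->
    (forall y, y \in l -> (exists2 t, X t & seg t y) \/ y \in Y) ->
    exists2 t, X t & forall y, y \in l -> seg t y \/ y \in Y.
  move=> [t0 Xt0] XD; elim: l => [|y l IHl] lP; first by exists t0.
  have [|t Xt tP] := IHl; first by move=> z zl; apply: lP; rewrite inE zl orbT.
  have [[t' Xt' t'y]|yY] := lP y (mem_head _ _); last first.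
    by exists t => // z; rewrite inE => /orP[/eqP ->|/tP//]; right.
  have up (u v w : K) : le u v -> seg u w -> seg v w.
    move=> uv [wu nwu]; split; first exact: wo_trans uv.
    by move=> wv; apply: nwu; apply: wo_anti => //; rewrite wv.
  have /orP[tt'|t't] := wo_total t t'.
    exists t' => // z; rewrite inE => /orP[/eqP ->|/tP[/(up _ _ _ tt')|]]; by [left|right].
  exists t => // z; rewrite inE => /orP[/eqP ->|/tP//]; left; exact: up t'y.
have cup (X : K -> Prop) x : (exists t, X t) -> (forall t, X t -> D t) ->
    set_clos (fun y => (exists2 t, X t & seg t y) \/ y \in Y) x ->
    exists2 t, X t & SC (seg t) Y x.
  move=> exX XD [l lP xl]; have [t Xt tP] := fin X l exX XD lP.
  by exists t => //; exists l.
apply: (@pdle_union _ _ k J S) => //.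
- by move=> [t Dt]; apply: IH.
- move=> [s Ds] [t Dt]; have /orP[st|ts] := wo_total s t.
    by left=> x; apply: Smono.
  by right=> x; apply: Smono.
- move=> X [[t1 Dt1] Xt1].
  pose X' t := exists j : J, X j /\ sval j = t.
  have exX' : exists t, X' t by exists t1; exists (exist _ t1 Dt1).
  have X'D t : X' t -> D t by move=> [[u Du] [_ <-]].
  (* A subfamily unbounded in [D] exhausts the chain. Otherwise the segment below its least upper
     bound [s0] is the union of the segments below its members. *)
  have [bd|nbd] := pselect (exists s, D s /\ forall t, X' t -> le t s); last first.
    right=> x xD; have [|t [j [Xj <-]] xt] := cup X' x exX' X'D; last by exists j.
    apply: set_clos_mono xD => y [Dy|]; last by right.
    left; apply: contrapT => nt; apply: nbd; exists y; split=> // t X't.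
    by have [yt|//] := seg_or_le y t; case: nt; exists t.
  have [s0 [Ds0 s0ub] s0min] := wo_min bd.
  left; exists (exist _ s0 Ds0) => x; split=> /= [xs|[j Xj]]; last first.
    by apply: Smono; apply: s0ub; exists j.
  have [|t [j [Xj <-]] xt] := cup X' x exX' X'D; last by exists j.
  apply: set_clos_mono xs => y [ys|]; last by right.
  left; apply: contrapT => nt; apply: (seg_not_le ys); apply: s0min; split.
    exact: Ddown ys.
  move=> t X't.
  by have [yt|//] := seg_or_le y t; case: nt; exists t.
- move=> x; split=> [xD|[[t Dt]]]; last first.
    apply: set_clos_mono => y /= [ty|]; last by right.
    by left; apply: Ddown ty.
  have [|t Dt xt] := cup D x (ex_intro _ d0 Dd0) (fun _ Dt => Dt); last first.
    by exists (exist _ t Dt).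
  apply: set_clos_mono xD => y [Dy|]; last by right.
  by left; have [t Dt ty] := next y Dy; exists t.
exact: (exist _ d0 Dd0).
Qed.

(** [pdle_initial] is the induction step for segments, and a last application with [D] all of [K]
    concludes. *)
Lemma pdle_closure_whole : pdle k K.
Proof.
have segQ t : forall Y, pdle k (submod_lmod (SC (seg t) Y)).
  elim/wo_ind: t => t IH; apply: pdle_initial => [u v vt uv|v vt Y].
    exact: seg_trans uv vt.
  exact: IH.
have := @pdle_initial (fun=> True) (fun _ _ _ _ => I) (fun t _ => segQ t) [::].
move=> pdS N; apply: (ExtN_iso_l (f := submod_incl _) _ (pdS N)).
split; first exact: submod_incl_inj.
move=> x; apply: submod_inclE; exists [:: x] => [y _|]; first by left.
by apply: span_gen; apply: clos_gen; rewrite mem_head.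
Qed.

End Closure.

Lemma flat_pd (F : lmodType R) k :
  (forall d M, pdle d M -> pdle k M) -> Flat F -> pdle k.+1 F.
Proof.
move=> pd_finite /flat_locally_split/choice[r /choice[g rgP]].
have [le wo_le] := well_ordering_principle (syz F).
have pdK : pdle k (syz F).
  apply: (@pdle_closure_whole _ _ (submod_incl (kernel (cover F))) r g) wo_le => //.
  - by move=> l x; have [+ _] := rgP l; apply.
  - by move=> l y; have [_] := rgP l; apply.
  - exact: free_proj.
by move=> N; apply/(extN_shift_l k N (@free_proj R F) (syz_ses F)).
Qed.

End Splitting.

(** * Values of the dimensions *)

Section Values.
Local Open Scope classical_set_scope.

(** Such values are determined by their natural upper bounds, which are all that gets compared
    below. *)
Definition natval (x : \bar int) := x = +oo%E \/ exists n : nat, x = (n%:Z)%:E.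

Lemma natval_eq x y : natval x -> natval y ->
  (forall n : nat, (x <= (n%:Z)%:E)%E <-> (y <= (n%:Z)%:E)%E) -> x = y.
Proof.
move=> [->|[a ->]] [->|[b ->]] // e.
- by have := (e b).2 (lexx _); rewrite leye_eq.
- by have := (e a).1 (lexx _); rewrite leye_eq.
by apply/eqP; rewrite eq_le (e b).2 // (e a).1.
Qed.

Lemma least_lengthP (P : nat -> Prop) :
  natval (least_length P) /\
  forall n : nat, (least_length P <= (n%:Z)%:E)%E <-> exists2 j, (j <= n)%N & P j.
Proof.
rewrite /least_length; set A := [set x | _].
have [ex|nex] := pselect (exists n, `[< P n >]); last first.
  have -> : A = set0.
    by apply/seteqP; split=> // x [n Pn _]; apply: nex; exists n; apply/asboolP.
  rewrite /infimum eqxx; split=> [|n]; first by left.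
  rewrite leye_eq; split=> // -[j _ Pj].
  by case: nex; exists j; apply/asboolP.
case: (ex_minnP ex) => p /asboolP Pp pmin.
have infA : infimums A (p%:Z)%:E.
  split=> [_ [n Pn ->]|x]; last by apply; exists p.
  by rewrite lee_fin lez_nat; apply: pmin; apply/asboolP.
have -> : infimum +oo%E A = (p%:Z)%:E.
  rewrite /infimum ifF; last first.
    by apply/negbTE/set0P; exists (p%:Z)%:E, p.
  by apply: xget_unique => // y Ay; apply: is_subset1_infimums infA.
split=> [|n]; first by right; exists p.
rewrite lee_fin lez_nat; split=> [pn|[j jn Pj]]; first by exists p.
by apply: leq_trans jn; apply: pmin; apply/asboolP.
Qed.

(** [supremum] is meaningful only if a least upper bound exists; it is the least natural upper
    bound, or [+oo] if there is none. *)
Lemma supremum_natval (A : set (\bar int)) :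
  A !=set0 -> (forall x, A x -> natval x) ->
  natval (supremum -oo%E A) /\ supremums A (supremum -oo%E A).
Proof.
move=> A0 natA.
suff [s [nats sA]] : exists s, natval s /\ supremums A s.
  rewrite (_ : supremum _ _ = s) // /supremum ifF; last exact/negbTE/set0P.
  by apply: xget_unique => // y Ay; apply: is_subset1_supremums sA.
have [ex|nex] := pselect (exists n : nat, `[< ubound A (n%:Z)%:E >]); last first.
  exists +oo%E; split; first by left.
  split=> [x _|u uA]; first exact: leey.
  have [x Ax] := A0; have xu := uA x Ax.
  case: u => [z| |] // in uA xu *; exfalso.
    apply: nex; exists `|z|%N; apply/asboolP => y /uA; move/le_trans; apply.
    by rewrite lee_fin abszE ler_norm.
  by move: xu; have [->|[n ->]] := natA x Ax.
case: (ex_minnP ex) => p /asboolP Ap pmin.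
exists (p%:Z)%:E; split; first by right; exists p.
split=> // u uA; have [x Ax] := A0; have xu := uA x Ax.
case: u => [z| |] in uA xu *; [|exact: leey|]; last first.
  by move: xu; have [->|[n ->]] := natA x Ax.
have z0 : 0 <= z.
  move: xu; have [->|[n ->]] := natA x Ax; first by rewrite leye_eq.
  by rewrite lee_fin; apply: le_trans.
case: z => // z in uA xu z0 *.
by rewrite lee_fin lez_nat; apply: pmin; apply/asboolP.
Qed.

Section SupOver.
Variables (R : pzRingType) (C : module_class R) (P : lmodType R -> nat -> Prop).
Let s := sup_over C (fun M => least_length (P M)).

(** The witness [M0] rules out [-oo], the supremum over an empty class. *)
Lemma sup_over_natval M0 : C M0 ->
  natval s /\ forall n : nat, (s <= (n%:Z)%:E)%E <->
    forall M, C M -> exists2 j, (j <= n)%N & P M j.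
Proof.
move=> CM0; have [||nats [ubs lbs]] :=
    @supremum_natval [set x | exists2 M, C M & x = least_length (P M)].
- by exists (least_length (P M0)), M0.
- by move=> _ [M _ ->]; have [] := least_lengthP (P M).
split=> // n; split=> [sn M CM|Pn].
  apply/(least_lengthP (P M)).2; apply: le_trans sn.
  by apply: ubs; exists M.
by apply: lbs => _ [M CM ->]; apply/(least_lengthP (P M)).2/Pn.
Qed.

Lemma sup_over_finite : (s < +oo)%E ->
  exists n, forall M, C M -> exists2 j, (j <= n)%N & P M j.
Proof.
have [[M0 CM0]|C0] := pselect (exists M, C M); last first.
  by exists 0%N => M CM; case: C0; exists M.
have [[->|[n sn]] sP] := sup_over_natval CM0; first by rewrite ltxx.
by move=> _; exists n; apply/sP; rewrite sn.
Qed.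

End SupOver.
End Values.

(** A cocycle factors through the image of [res_diff P 0], from which it extends by injectivity. So
    a bound on pd(FPInj) also bounds pd(Inj). *)
Lemma inj_FPInj (R : pzRingType) (I : lmodType R) : Inj I -> FPInj I.
Proof.
move=> injI N _ P _ f fd.
pose S := range_submod (res_diff P 0%N).
have [b bP] := @corestrict _ _ _ S (res_diff P 0%N) (fun x => ex_intro _ x erefl).
have sb : surjective_map b.
  move=> y; have [x xP] := submod_inclP y.
  by exists x; apply: submod_incl_inj; rewrite bP.
have exb : exact_at (res_diff P 1%N) b.
  move=> y; rewrite -res_exact -bP; split=> [->|e]; first exact: linear0.
  by apply: submod_incl_inj; rewrite e linear0.
have [h hP] := factor_coker sb exb fd.
have [g gP] := injI _ _ (submod_incl S) h (@submod_incl_inj _ _ S).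
by exists g => x; rewrite -bP gP hP.
Qed.

Theorem proposition3p16 (R : pzRingType) :
  (pd_class (@FPInj R) < +oo)%E ->
  (id_class (@Proj R) < +oo)%E ->
  [/\ glDP R = glDI R,
      glGP R = glGI R,
      glGP R = glDP R &
      (glDP R < +oo)%E].
Proof.
move=> /sup_over_finite[n nP] /sup_over_finite[m mP].
have pdFP (M : lmodType R) : FPInj M -> pdle n M.
  move=> /nP[j jn /reslen_of_res/reslen_pdle]; exact: pdle_leq.
have pdI (M : lmodType R) : Inj M -> pdle n M by move=> /inj_FPInj/pdFP.
have idPm (M : lmodType R) : Proj M -> idle m M.
  move=> /mP[j jm /coreslen_of_cores/coreslen_idle]; exact: idle_leq.
(* The bound [m] improves to [n], the bound for pd(FPInj), which becomes the uniform bound for all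
   finite projective dimensions. *)
have idP := (pd_inj_iff_id_proj pdI idPm n).1 pdI.
have pd_finite d (M : lmodType R) : pdle d M -> pdle n M.
  by apply: pd_descend => Q j projQ nj; apply: (idle_leq nj (idP Q projQ)).
have GPE (Y : module_class R) : (forall N, Y N -> exists d, pdle d N) ->
    GProj (@Proj R) Y = exact_cycle (@Proj R).
  exact: GProj_exact_cycle idP.
have GIE (X : module_class R) : (forall N, X N -> exists d, pdle d N) ->
    GInj X (@Inj R) = exact_cycle (@Inj R).
  exact: GInj_exact_cycle.
have DPE : glDP R = glGP R.
  rewrite /glDP /glGP /glGPD !GPE // => N.
    by exists 0%N; apply: pdle_proj.
  (* [n] bounds the pd of the syzygy of a flat module, hence [n.+1] here. *)
  by exists n.+1; apply: flat_pd.
have DIE : glDI R = glGI R.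
  by rewrite /glDI /glGI /glGID !GIE // => N; exists n; auto.
have [natGP GPP] := @sup_over_natval R (@AllModules R)
  (has_resolution_of_length (GProj (@Proj R) (@Proj R))) 'rV[R]_0 I.
have [natGI GIP] := @sup_over_natval R (@AllModules R)
  (has_coresolution_of_length (GInj (@Inj R) (@Inj R))) 'rV[R]_0 I.
have GPk k : (glGP R <= (k%:Z)%:E)%E <-> forall M : lmodType R, Inj M -> pdle k M.
  rewrite GPP -(gorenstein_proj_dim pdI idP) GPE; last first.
    by move=> N projN; exists 0%N; apply: pdle_proj.
  split=> [h M|h M _]; first by have [j jk /reslen_of_res] := h M I; exists j.
  by have [j jk /res_of_reslen] := h M; exists j.
have GIk k : (glGI R <= (k%:Z)%:E)%E <-> forall M : lmodType R, Proj M -> idle k M.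
  rewrite GIP -(gorenstein_inj_dim pdI idP) GIE; last first.
    by move=> N /pdI pdN; exists n.
  split=> [h M|h M _]; first by have [j jk /coreslen_of_cores] := h M I; exists j.
  by have [j jk /cores_of_coreslen] := h M; exists j.
have GPGI : glGP R = glGI R.
  apply: natval_eq => // k.
  by rewrite GPk GIk (pd_inj_iff_id_proj pdI idP).
split=> //; first by rewrite DPE DIE.
(* By [GPk], pd(Inj) <= n bounds the common value by [n]. *)
rewrite DPE; apply: (@le_lt_trans _ _ (n%:Z)%:E); last exact: ltry.
exact/GPk.
Qed.
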